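(* For every integer $n\ge 4$, there exists an open (i.e. complete and noncompact) Riemannian $n$-manifold $N$ with positive Ricci curvature whose spherical Busemann function $\hat b_p$ (at a point $p\in N$) is not proper.
   Context: For an open Riemannian manifold $N$ with distance function $d$ and a point $p\in N$, let $S_t(p)=\{q\in N : d(p,q)=t\}$ be the geodesic sphere of radius $t$ at $p$. The spherical Busemann function at $p$ is $$\hat b_p(x)=\lim_{t\to\infty}\bigl(t-d(x,S_t(p))\bigr),\qquad x\in N.$$ The function $\hat b_p$ is called proper if the sublevel set $\hat b_p^{-1}(-\infty,a]$ is compact for every $a\in\mathbb{R}$. (On an open manifold it is known that properness of $\hat b_p$ does not depend on the choice of $p$, so one may speak of the spherical Busemann function of $N$ being proper or not.) *)

(* Defs.v *)
From HB Require Import structures.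
From mathcomp Require Import all_boot all_order all_algebra.
From mathcomp Require Import all_classical all_reals all_analysis.

Set Implicit Arguments.
Unset Strict Implicit.
Unset Printing Implicit Defensive.

Import Order.TTheory GRing.Theory Num.Theory.
Import numFieldNormedType.Exports.

Local Open Scope classical_set_scope.
Local Open Scope ring_scope.

Definition partial (R : realType) (n : nat) (j : 'I_n) (f : 'rV[R]_n -> R)
    (x : 'rV[R]_n) : R :=
  'D_(delta_mx 0 j : 'rV[R]_n) f x.

(* Meaningful for U open: all iterated partial derivatives of order <= k exist
   and are continuous on U. *)
Fixpoint Ck (R : realType) (n : nat) (k : nat) (U : set 'rV[R]_n)
    (f : 'rV[R]_n -> R) : Prop :=
  (forall x, U x -> {for x, continuous f}) /\
  (if k is k'.+1 then
     forall j : 'I_n,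
       (forall x, U x -> derivable f x (delta_mx 0 j : 'rV[R]_n)) /\
       Ck k' U (partial j f)
   else True).

Definition smooth_on (R : realType) (n : nat) (U : set 'rV[R]_n)
    (f : 'rV[R]_n -> R) : Prop := forall k, Ck k U f.

(* Connected smooth n-manifolds without boundary, presented by a smooth atlas
   (not required to be maximal).  The functions [chart i] and [chart_inv i]
   are total, but only their values on [chart_dom i] and on its image
   matter.  [chart_at] picks a chart around each point, so that the charts
   cover the manifold. *)
Record smooth_manifold (R : realType) (n : nat) := SmoothManifold {
  points :> topologicalType ;
  points_hausdorff : hausdorff_space points ;
  points_second_countable : @second_countable points ;
  points_connected : connected [set: points] ;
  chart_index : Type ;
  chart_dom : chart_index -> set points ;
  chart : chart_index -> points -> 'rV[R]_n ;
  chart_inv : chart_index -> 'rV[R]_n -> points ;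
  chart_at : points -> chart_index ;
  chart_atP : forall x, chart_dom (chart_at x) x ;
  chart_dom_open : forall i, open (chart_dom i) ;
  chart_image_open : forall i, open (chart i @` chart_dom i) ;
  chartK : forall i x, chart_dom i x -> chart_inv i (chart i x) = x ;
  chart_continuous : forall i x, chart_dom i x ->
    {for x, continuous (chart i)} ;
  chart_inv_continuous : forall i u, (chart i @` chart_dom i) u ->
    {for u, continuous (chart_inv i)} ;
  transition_smooth : forall i j (b : 'I_n),
    smooth_on (chart i @` (chart_dom i `&` chart_dom j))
              (fun u => chart j (chart_inv i u) 0 b)
}.

(* [metric i u] is the Gram matrix of the metric in the coordinate frame of
   chart i, at the point of coordinates u.  Tangent vectors are row vectors
   and Jacobian matrices act on the right, whence the change of coordinates
   formula [metric_compat]. *)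
Record riemannian_manifold (R : realType) (n : nat) := RiemannianManifold {
  underlying :> smooth_manifold R n ;
  metric : chart_index underlying -> 'rV[R]_n -> 'M[R]_n ;
  metric_smooth : forall i (a b : 'I_n),
    smooth_on (chart i @` chart_dom i) (fun u => metric i u a b) ;
  metric_symmetric : forall i u, (chart i @` chart_dom i) u ->
    (metric i u)^T = metric i u ;
  metric_posdef : forall i u (v : 'rV[R]_n), (chart i @` chart_dom i) u ->
    v != 0 -> 0 < (v *m metric i u *m v^T) 0 0 ;
  metric_compat : forall i j x, chart_dom i x -> chart_dom j x ->
    let J := 'J (chart j \o chart_inv i) (chart i x) in
    metric i (chart i x) = J *m metric j (chart j x) *m J^T
}.

Section Curvature.
Variables (R : realType) (n : nat) (g : 'rV[R]_n -> 'M[R]_n).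
Implicit Types (i j k l p : 'I_n) (u : 'rV[R]_n).

(* christoffel k i j is Gamma^k_{ij}. *)
Definition christoffel k i j u : R :=
  2^-1 * \sum_l invmx (g u) k l *
    (partial i (fun w => g w j l) u + partial j (fun w => g w i l) u
     - partial l (fun w => g w i j) u).

(* riemann l i j k is the component R^l_{ijk} in the convention
   Rm(X, Y) Z = D_X D_Y Z - D_Y D_X Z - D_[X,Y] Z, that is
   Rm(e_i, e_j) e_k = \sum_l R^l_{ijk} e_l on coordinate fields. *)
Definition riemann l i j k u : R :=
  partial i (christoffel l j k) u - partial j (christoffel l i k) u
  + \sum_p (christoffel l i p u * christoffel p j k u
            - christoffel l j p u * christoffel p i k u).

(* Ric(Y, Z) is the trace of X |-> Rm(X, Y) Z, so that round spheres have
   positive Ricci curvature. *)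
Definition ricci u : 'M[R]_n := \matrix_(j, k) \sum_i riemann i i j k u.

End Curvature.

Definition positive_ricci (R : realType) (n : nat)
    (N : riemannian_manifold R n) : Prop :=
  forall (i : chart_index N) (u v : 'rV[R]_n),
    (chart i @` chart_dom i) u -> v != 0 ->
    0 < (v *m ricci (metric i) u *m v^T) 0 0.

Section Distance.
Variables (R : realType) (n : nat) (N : riemannian_manifold R n).

(* C^1 curves defined on the closed interval [0, 1], in the sense that they are
   C^1 on some open interval containing it. *)
Definition C1_curve (c : R -> N) : Prop :=
  forall t, 0 <= t <= 1 -> forall i, chart_dom i (c t) ->
    (\forall s \near t,
       {for s, continuous c} /\ derivable (chart i \o c) s 1) /\
    {for t, continuous (derive1 (chart i \o c))}.

Definition speed (c : R -> N) (t : R) : R :=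
  let i := chart_at (c t) in
  let v := derive1 (chart i \o c) t in
  Num.sqrt ((v *m metric i (chart i (c t)) *m v^T) 0 0).

Definition curve_length (c : R -> N) : \bar R :=
  (\int[lebesgue_measure]_(t in `[0%R, 1%R]) (speed c t)%:E)%E.

(* A piecewise C^1 curve from x to y is given by its consecutive C^1 pieces,
   each one parametrized by [0, 1]. *)
Fixpoint piecewise_C1 (x y : N) (s : seq (R -> N)) : Prop :=
  if s is c :: s' then [/\ C1_curve c, c 0 = x & piecewise_C1 (c 1) y s']
  else x = y.

Definition dist (x y : N) : \bar R :=
  ereal_inf [set (\sum_(c <- s) curve_length c)%E | s in piecewise_C1 x y].

Definition dist_set (x : N) (S : set N) : \bar R :=
  ereal_inf [set dist x y | y in S].

Definition geodesic_sphere (t : R) (p : N) : set N :=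
  [set q | dist p q = t%:E].

(* b is the pointwise limit of t - d(x, S_t(p)); in particular the limit exists
   and is finite. *)
Definition is_spherical_busemann (p : N) (b : N -> R) : Prop :=
  forall x, (t%:E - dist_set x (geodesic_sphere t p))%E @[t --> +oo%R]
              --> (b x)%:E.

(* Completeness of the metric space (N, d). *)
Definition complete_manifold : Prop :=
  forall x : nat -> N,
    (forall e : R, 0 < e -> exists m : nat, forall k l : nat,
       (m <= k)%N -> (m <= l)%N -> (dist (x k) (x l) < e%:E)%E) ->
    exists y : N, forall e : R, 0 < e -> exists m : nat, forall k : nat,
       (m <= k)%N -> (dist (x k) y < e%:E)%E.

Definition open_manifold : Prop :=
  complete_manifold /\ ~ compact [set: N].

Definition proper_function (b : N -> R) : Prop :=
  forall a : R, compact [set x | b x <= a].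

End Distance.

(* Main.v *)
(** On R^n = R^(n-1) x R, with s = |x|^2 for x in R^(n-1), L = 8 + ln (1 + s)
    and v the last coordinate, take
    g = L^4 / (1 + s) |dx|^2 + L^-1 dv^2.
    In the radial distance r the spheres have radius of order r^(2/3) and the
    length of d/dv decays like r^(-1/6), slowly enough for every Ricci
    eigenvalue to be positive: up to positive factors these are polynomials in
    1 / L and s / (1 + s), and affine in n.  The function L is 1-Lipschitz, and
    along a curve |dv| is at most L^(1/2) times the arc length, so balls are
    bounded and g is complete.

    Since d/dv becomes short at infinity, the Busemann function is bounded on
    vertical lines.  Let x = p + w d/dv.  A path from x to a far point q of
    S_t(p) either reaches the region L >= w^2, where one can shift the first
    part of the path vertically by w at cost at most 1, so that
    t = d(p, q) <= length + 1; or it stays in a region where d/dv is at least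
    twice as long as farther out, and then the detour through the outer region
    gives t <= length / 2 + const.  Hence b_p(x) <= 1 for every w. *)
Require Import Defs.
From mathcomp Require Import all_boot all_order all_algebra.
From mathcomp Require Import all_classical all_reals all_analysis.
From mathcomp Require Import ring lra.

Set Implicit Arguments.
Unset Strict Implicit.
Unset Printing Implicit Defensive.

Import Order.TTheory GRing.Theory Num.Theory.
Import numFieldNormedType.Exports.

Local Open Scope classical_set_scope.
Local Open Scope ring_scope.

(** * Calculus of the metric coefficients *)

Lemma derive_scalar_comp (R : realType) (V : normedModType R) (f : V -> R)
    (g : R -> R) (x v : V) (dg : R) :
  differentiable f x -> is_derive (f x) 1 g dg ->
  'D_v (g \o f) x = dg * 'D_v f x.
Proof.
move=> df [gd <-].
have dg' : differentiable g (f x) by apply/derivable1_diffP.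
rewrite deriveE; last exact: differentiable_comp.
by rewrite diff_comp //= deriv1E //= (deriveE _ df) /GRing.scale /= derive1E mulrC.
Qed.

Section Functions.
Variables (R : realType) (m : nat).
Implicit Types (u v : 'rV[R]_m.+1) (i j k l p : 'I_m.+1).

(* The last coordinate is the vertical one; [hx i u] is the [i]-th coordinate of
   the horizontal part of [u]. *)
Definition hor i : R := (i != ord_max)%:R.
Definition hx i u : R := hor i * u 0 i.
Definition sq u : R := \sum_i (hx i u) ^+ 2.
Definition rat_s u : R := (1 + sq u)^-1.
(** The summand 8 gives [8 * inv_log u <= 1], the smallness that the Ricci inequalities below rely
    on. *)
Definition log_s u : R := 8 + ln (1 + sq u).
Definition inv_log u : R := (log_s u)^-1.

Lemma sq_ge0 u : 0 <= sq u.
Proof. by apply: sumr_ge0 => i _; apply: sqr_ge0. Qed.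

Lemma sq1_gt0 u : 0 < 1 + sq u.
Proof. by rewrite ltr_wpDr // sq_ge0. Qed.

Lemma rat_s_gt0 u : 0 < rat_s u.
Proof. by rewrite invr_gt0 sq1_gt0. Qed.

Lemma log_s_ge8 u : 8 <= log_s u.
Proof. by rewrite lerDl ln_ge0 // lerDl sq_ge0. Qed.

Lemma log_s_gt0 u : 0 < log_s u.
Proof. by apply: lt_le_trans (log_s_ge8 u). Qed.

Lemma inv_log_gt0 u : 0 < inv_log u.
Proof. by rewrite invr_gt0 log_s_gt0. Qed.

Lemma differentiable_hx i u : differentiable (hx i) u.
Proof.
apply: differentiableM => //.
exact: (@differentiable_coord R 1 m.+1).
Qed.

Lemma partial_coord l i u :
  partial l (fun w : 'rV[R]_m.+1 => w 0 i) u = (l == i)%:R.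
Proof.
have := @derive_mx R _ 1 m.+1 id u (delta_mx 0 l) (@derivable_id _ _ _ _).
rewrite derive_id => /matrixP /(_ 0 i).
by rewrite !mxE eqxx /= eq_sym => ->.
Qed.

Lemma partial_hx l i u : partial l (hx i) u = hor i * (l == i)%:R.
Proof.
rewrite /partial /hx.
rewrite (_ : (fun _ => _) = (hor i *: (fun w : 'rV[R]_m.+1 => w 0 i))); last first.
  by apply/funext.
have dc : differentiable (fun w : 'rV[R]_m.+1 => w 0 i) u.
  exact: (@differentiable_coord R 1 m.+1).
rewrite deriveZ; last exact: diff_derivable.
by congr (_ * _); apply: partial_coord.
Qed.

Lemma sqE : sq = \sum_i ((hx i) ^+ 2 : 'rV[R]_m.+1 -> R).
Proof. by apply/funext => u; rewrite fct_sumE. Qed.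

Lemma differentiable_sq u : differentiable sq u.
Proof.
rewrite sqE; apply: differentiable_sum => i.
apply: differentiableX; exact: differentiable_hx.
Qed.

Lemma partial_sq l u : partial l sq u = 2 * hx l u.
Proof.
rewrite /partial sqE derive_sum; last first.
  move=> i; apply: diff_derivable; apply: differentiableX.
  exact: differentiable_hx.
rewrite (bigD1 l) //= big1 ?addr0.
  rewrite deriveX; last exact/diff_derivable/differentiable_hx.
  have /= := partial_hx l l u; rewrite /partial => ->.
  rewrite eqxx mulr1 expr1 /GRing.scale /= /hx /hor.
  by case: (l != _); rewrite ?mul1r ?mul0r ?mulr0 ?mulr1 // mulr_natl.
move=> i il; rewrite deriveX; last exact/diff_derivable/differentiable_hx.
have /= := partial_hx l i u; rewrite /partial => ->.
by rewrite eq_sym (negbTE il) mulr0 scaler0.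
Qed.

Lemma differentiable_sq1 u : differentiable (fun w => 1 + sq w) u.
Proof.
have := differentiableD (@differentiable_cst R _ _ (1 : R) u) (differentiable_sq u).
exact.
Qed.

Lemma partial_sq1 l u : partial l (fun w => 1 + sq w) u = 2 * hx l u.
Proof.
rewrite /partial (@deriveD R 'rV[R]_m.+1 R (cst 1) sq) //.
  by rewrite derive_cst add0r; apply: partial_sq.
exact/diff_derivable/differentiable_sq.
Qed.

Lemma differentiable_inv (f : 'rV[R]_m.+1 -> R) u : f u != 0 ->
  differentiable f u -> differentiable (fun w => (f w)^-1) u.
Proof. by move=> f0 df; apply: differentiableV. Qed.

Lemma partial_inv (f : 'rV[R]_m.+1 -> R) l u : f u != 0 ->
  differentiable f u ->
  partial l (fun w => (f w)^-1) u = - (f u) ^- 2 * partial l f u.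
Proof.
by move=> f0 df; rewrite /partial deriveV //; exact: diff_derivable.
Qed.

Lemma differentiable_rat_s u : differentiable rat_s u.
Proof.
by apply: differentiable_inv; rewrite ?gt_eqF ?sq1_gt0 //; apply: differentiable_sq1.
Qed.

Lemma partial_rat_s l u :
  partial l rat_s u = - (2 * hx l u * (rat_s u * rat_s u)).
Proof.
rewrite partial_inv ?gt_eqF ?sq1_gt0 //; last exact: differentiable_sq1.
by rewrite partial_sq1 /rat_s -exprVn expr2; ring.
Qed.

Lemma differentiable_log_s u : differentiable log_s u.
Proof.
apply: (@differentiableD R 'rV[R]_m.+1 R (cst 8) (@ln R \o (fun w => 1 + sq w))) => //.
apply: (@differentiable_comp _ _ _ _ (fun w => 1 + sq w) (@ln R)).
  exact: differentiable_sq1.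
have [d _] := is_derive1_ln (sq1_gt0 u).
by apply/derivable1_diffP.
Qed.

Lemma partial_log_s l u : partial l log_s u = 2 * hx l u * rat_s u.
Proof.
have dl : differentiable (@ln R \o (fun w => 1 + sq w)) u.
  apply: differentiable_comp; first exact: differentiable_sq1.
  have [d _] := is_derive1_ln (sq1_gt0 u).
  by apply/derivable1_diffP.
rewrite /partial (@deriveD R 'rV[R]_m.+1 R (cst 8) (@ln R \o (fun w => 1 + sq w))) //; last first.
  exact: diff_derivable.
rewrite derive_cst add0r.
rewrite (derive_scalar_comp _ (differentiable_sq1 u) (is_derive1_ln (sq1_gt0 u))).
by rewrite mulrC -/(rat_s u); congr (_ * _); apply: partial_sq1.
Qed.

Lemma differentiable_inv_log u : differentiable inv_log u.
Proof.
by apply: differentiable_inv; rewrite ?gt_eqF ?log_s_gt0 //; apply: differentiable_log_s.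
Qed.

Lemma partial_inv_log l u :
  partial l inv_log u = - (2 * hx l u * rat_s u * (inv_log u * inv_log u)).
Proof.
rewrite partial_inv ?gt_eqF ?log_s_gt0 //; last exact: differentiable_log_s.
by rewrite partial_log_s /inv_log -exprVn expr2; ring.
Qed.

(* An algebra of functions closed under partial derivatives, which contains the
   coefficients of the metric and its Christoffel symbols: this gives
   smoothness, and reduces differentiation to a syntactic computation. *)
Inductive expr :=
  | Cst of R | Coord of 'I_m.+1 | Rat | Log | Inv
  | Add of expr & expr | Mul of expr & expr.

Fixpoint ev (e : expr) : 'rV[R]_m.+1 -> R :=
  match e with
  | Cst r => cst r
  | Coord i => hx i
  | Rat => rat_s
  | Log => log_s
  | Inv => inv_log
  | Add e1 e2 => ev e1 + ev e2
  | Mul e1 e2 => ev e1 * ev e2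
  end.

Fixpoint dexpr l (e : expr) : expr :=
  match e with
  | Cst r => Cst 0
  | Coord i => Cst (hor i * (l == i)%:R)
  | Rat => Mul (Mul (Cst (-2)) (Coord l)) (Mul Rat Rat)
  | Log => Mul (Mul (Cst 2) (Coord l)) Rat
  | Inv => Mul (Mul (Mul (Cst (-2)) (Coord l)) Rat) (Mul Inv Inv)
  | Add e1 e2 => Add (dexpr l e1) (dexpr l e2)
  | Mul e1 e2 => Add (Mul (dexpr l e1) e2) (Mul e1 (dexpr l e2))
  end.

Lemma differentiable_ev e u : differentiable (ev e) u.
Proof.
elim: e => [r|i||||e1 h1 e2 h2|e1 h1 e2 h2] /=.
- exact: differentiable_cst.
- exact: differentiable_hx.
- exact: differentiable_rat_s.
- exact: differentiable_log_s.
- exact: differentiable_inv_log.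
- exact: differentiableD.
- exact: differentiableM.
Qed.

Lemma partial_ev l e : partial l (ev e) = ev (dexpr l e).
Proof.
apply/funext => u.
elim: e => [r|i||||e1 h1 e2 h2|e1 h1 e2 h2] /=.
- exact: derive_cst.
- exact: partial_hx.
- rewrite partial_rat_s.
  change (- (2 * hx l u * (rat_s u * rat_s u)) = -2 * hx l u * (rat_s u * rat_s u)).
  by ring.
- by rewrite partial_log_s.
- rewrite partial_inv_log.
  change (- (2 * hx l u * rat_s u * (inv_log u * inv_log u)) =
    -2 * hx l u * rat_s u * (inv_log u * inv_log u)).
  by ring.
- rewrite /partial deriveD; [|exact/diff_derivable/differentiable_ev..].
  by congr (_ + _).
- rewrite /partial deriveM; [|exact/diff_derivable/differentiable_ev..].
  rewrite addrC; congr (_ + _); last by congr (_ * _).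
  by rewrite [LHS]mulrC; congr (_ * _).
Qed.

(** The induction on the order treats all expressions at once, because [partial_ev] turns each
    partial derivative into another expression. *)
Lemma smooth_ev e U : smooth_on U (ev e).
Proof.
move=> k; elim: k e => [|k IH] e /=; split => //.
- by move=> x _; apply/differentiable_continuous/differentiable_ev.
- by move=> x _; apply/differentiable_continuous/differentiable_ev.
- move=> j; split.
    by move=> x _; apply/diff_derivable/differentiable_ev.
  by rewrite partial_ev.
Qed.

End Functions.

(** * Ricci curvature *)

Section Contraction.
Variables (R : comPzRingType) (n : nat) (x h mu nu mu' nu' : 'I_n -> R).
Variables (N s a b a' b' : R).
Implicit Types i j k l p : 'I_n.

Let d i j : R := (i == j)%:R.

(* The Christoffel symbols of a diagonal metric e^(2 u_i) dx_i^2 where u_i depends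
   only on |x|^2, with mu_i x_j = d_j u_i and nu_i x_k = e^(2 u_i - 2 u_k) d_k u_i;
   x is the horizontal part of the position, mu' and nu' are twice the
   derivatives of mu and nu in |x|^2, and h is the indicator of the horizontal
   indices. *)
Definition warped_gamma k i j : R :=
  d j k * (mu k * x i) + d i k * (mu k * x j) - d i j * (nu i * x k).

Definition warped_dgamma l k i j : R :=
  d j k * (mu' k * x l * x i + mu k * (h i * d l i)) +
  d i k * (mu' k * x l * x j + mu k * (h j * d l j)) -
  d i j * (nu' i * x l * x k + nu i * (h k * d l k)).

(** In the intended case [x] and [h] vanish in the vertical direction, so a product with either sees
    only the common horizontal value [a] of [mu] and [nu]. The scalar [b] is the vertical value of
    [mu], and [N] counts the horizontal indices. *)
Hypothesis xmu : forall i, mu i * x i = a * x i.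
Hypothesis xnu : forall i, nu i * x i = a * x i.
Hypothesis xmu' : forall i, mu' i * x i = a' * x i.
Hypothesis xnu' : forall i, nu' i * x i = a' * x i.
Hypothesis hmu : forall i, mu i * h i = a * h i.
Hypothesis hnu : forall i, nu i * h i = a * h i.
Hypothesis hS : \sum_i h i = N.
Hypothesis xS : \sum_i x i ^+ 2 = s.
Hypothesis muS : \sum_i mu i = N * a + b.
Hypothesis mu2S : \sum_i mu i ^+ 2 = N * a ^+ 2 + b ^+ 2.
Hypothesis mu'S : \sum_i mu' i = N * a' + b'.

Lemma sum_deltal k (F : 'I_n -> R) : \sum_i d i k * F i = F k.
Proof.
rewrite (bigD1 k) //= /d eqxx mul1r big1 ?addr0 // => i /negbTE ->.
by rewrite mul0r.
Qed.

Lemma sum_deltar k (F : 'I_n -> R) : \sum_i d k i * F i = F k.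
Proof. by under eq_bigr do rewrite /d eq_sym; exact: sum_deltal. Qed.

Lemma delta_sym i j : d i j = d j i.
Proof. by rewrite /d eq_sym. Qed.

Lemma delta_subst i j (F : 'I_n -> R) : d i j * F i = d i j * F j.
Proof. by rewrite /d; case: eqP => [->|]; rewrite ?mul0r. Qed.

Lemma delta_diag i : d i i = 1.
Proof. by rewrite /d eqxx. Qed.

(** The Ricci term $\partial_i \Gamma^i_{jk}$. *)
Lemma warped_div j k : \sum_i warped_dgamma i i j k =
  2 * a' * (x j * x k) + d j k * (2 * a * h j - nu' j * s - nu j * N).
Proof.
under eq_bigr => i _ do rewrite /warped_dgamma.
rewrite sumrB big_split /= !sum_deltar.
transitivity (a' * (x j * x k) + d j k * (a * h j) + (a' * (x j * x k) + d j k * (a * h j))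
   - d j k * (nu' j * s + nu j * N)); last by ring.
congr (_ + _ - _).
- rewrite xmu' (delta_sym k j).
  have -> : mu k * (h j * d j k) = d j k * (mu k * h j) by ring.
  rewrite -(delta_subst j k (fun i => mu i * h j)) /= hmu; ring.
- rewrite xmu'.
  have -> : mu j * (h k * d j k) = d j k * (mu j * h k) by ring.
  rewrite (delta_subst j k (fun i => mu i * h k)) /= hmu.
  rewrite -(delta_subst j k (fun i => a * h i)) /=; ring.
- rewrite -mulr_sumr; congr (_ * _).
  rewrite -xS -hS !mulr_sumr -big_split /=; apply: eq_bigr => i _.
  by rewrite delta_diag; ring.
Qed.

(** The Ricci term $\partial_j \Gamma^i_{ik}$, the Hessian of the logarithm of the volume
    density. *)
Lemma warped_dtrace j k : \sum_i warped_dgamma j i i k =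
  (N * a' + b') * (x j * x k) + d j k * ((N * a + b) * h j).
Proof.
under eq_bigr => i _ do rewrite /warped_dgamma.
rewrite sumrB big_split /= sum_deltar sum_deltal.
have -> : \sum_i d i i * (mu' i * x j * x k + mu i * (h k * d j k)) =
   (N * a' + b') * (x j * x k) + d j k * ((N * a + b) * h j).
  transitivity ((\sum_i mu' i) * (x j * x k) + (\sum_i mu i) * (h k * d j k)).
    rewrite !mulr_suml -big_split; apply: eq_bigr => i _ /=.
    by rewrite delta_diag; ring.
  rewrite mu'S muS; congr (_ + _).
  by rewrite mulrCA [RHS]mulrCA (delta_subst j k h) mulrC; ring.
have -> : mu' k * x j * x k = x j * (mu' k * x k) by ring.
have -> : nu' k * x j * x k = x j * (nu' k * x k) by ring.
have -> : mu k * (h k * d j k) = d j k * (mu k * h k) by ring.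
have -> : nu k * (h k * d j k) = d j k * (nu k * h k) by ring.
rewrite xmu' xnu' hmu hnu; ring.
Qed.

Lemma warped_trace p : \sum_i warped_gamma i i p = (N * a + b) * x p.
Proof.
under eq_bigr => i _ do rewrite /warped_gamma.
rewrite sumrB big_split /= sum_deltar sum_deltal xmu xnu.
have -> : \sum_i d i i * (mu i * x p) = (\sum_i mu i) * x p.
  by rewrite mulr_suml; apply: eq_bigr => i _; rewrite delta_diag mul1r.
rewrite muS; ring.
Qed.

Lemma warped_trace_gamma j k :
  \sum_i \sum_p warped_gamma i i p * warped_gamma p j k =
  (N * a + b) * (2 * a * (x j * x k) - d j k * (nu j * s)).
Proof.
rewrite exchange_big /=.
under eq_bigr => p _ do rewrite -mulr_suml warped_trace -mulrA.
rewrite -mulr_sumr; congr (_ * _).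
transitivity (\sum_p (d k p * (x p * (mu p * x j)) + d j p * (x p * (mu p * x k)) - d j k * (nu j * x p ^+ 2))).
  by apply: eq_bigr => p _; rewrite /warped_gamma; ring.
rewrite sumrB big_split /= !sum_deltar -mulr_sumr -mulr_sumr xS.
have -> : x k * (mu k * x j) = (mu k * x k) * x j by ring.
have -> : x j * (mu j * x k) = (mu j * x j) * x k by ring.
rewrite !xmu; ring.
Qed.

(** The Ricci term $\Gamma^i_{jp} \Gamma^p_{ik}$. *)
Lemma warped_gamma_sq j k :
  \sum_i \sum_p warped_gamma i j p * warped_gamma p i k =
  ((N + 2) * a ^+ 2 + b ^+ 2) * (x j * x k) - 2 * d j k * (mu j * nu j * s).
Proof.
(* This summand is the result of summing over [p] first; the deltas in [i] are kept for the second
   summation. *)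
transitivity (\sum_i (
   d k i * (mu i * x j * mu i * x i) + (mu i ^+ 2 * (x j * x k))
   - d i k * (mu i * x j * (nu i * x i))
   + d j i * (mu i * x k * (mu k * x i) + mu i * (mu i * x i) * x k
              - d i k * (nu i * (mu i * s)))
   - (d j k * (nu j * x i * (mu j * x i)) + d j i * (nu j * x i * (mu j * x k))
              - d i k * (nu j * x i * (nu i * x j))))).
  apply: eq_bigr => i _.
  transitivity (\sum_p (
    d p i * ((mu i * x j) * warped_gamma p i k) +
    d j i * (mu i * (d k p * (x p * (mu p * x i)) + d i p * (x p * mu p * x k) - d i k * (nu i * x p ^+ 2)))
    - d j p * (nu j * x i * warped_gamma p i k))).
    by apply: eq_bigr => p _; rewrite /warped_gamma; ring.
  rewrite sumrB big_split /= sum_deltal sum_deltar -!mulr_sumr.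
  rewrite sumrB big_split /= !sum_deltar -!mulr_sumr xS.
  have xk : x k * (mu k * x i) = a * x k * x i by rewrite mulrA [x k * _]mulrC xmu.
  rewrite xk /warped_gamma [x i * mu i]mulrC.
  have e1 : d j k * (mu k * x i) = d j k * (mu j * x i).
    by rewrite -(delta_subst j k (fun j => mu j * x i)) /=.
  have ii : d i i = 1 by rewrite delta_diag.
  have e2 : d i j * (mu j * x k) = d j i * (mu j * x k) by rewrite delta_sym.
  have e3 : mu i * x k * (mu k * x i) = mu i * (a * x k * x i).
    by rewrite -xk; ring.
  rewrite e3 ii.
  have e4 : d k j * (mu j * x i) = d j k * (mu j * x i) by rewrite delta_sym.
  rewrite ?e4 ?e1 e2; ring.
rewrite !(big_split, sumrN) /=.
rewrite !(sum_deltar, sum_deltal) -!mulr_sumr -mulr_suml mu2S.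
have -> : \sum_i nu j * x i * (mu j * x i) = mu j * nu j * s.
  by rewrite -xS mulr_sumr; apply: eq_bigr => i _; ring.
have -> : mu k * x j * mu k * x k = (mu k * x k) * mu k * x j by ring.
have -> : mu j * x k * (mu k * x j) = (mu k * x k) * (mu j * x j) by ring.
have -> : nu j * x j * (mu j * x k) = (nu j * x j) * mu j * x k by ring.
have -> : nu j * x k * (nu k * x j) = (nu j * x j) * (nu k * x k) by ring.
have -> : mu k * x k * mu k * x j = a * (mu k * x k) * x j by rewrite {1}xmu; ring.
have -> : nu j * x j * mu j * x k = a * (mu j * x j) * x k by rewrite xnu; ring.
have -> : mu k * x j * (nu k * x k) = a * (mu k * x k) * x j by rewrite xnu; ring.
have -> : mu j * (mu j * x j) * x k = a * (mu j * x j) * x k by rewrite {1}xmu; ring.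
rewrite !xmu !xnu; ring.
Qed.

(** The four contractions combine into a rank-one matrix in [x] plus a diagonal one. The two
    coefficients become [ricP] and [ricQ]. *)
Lemma warped_ricci j k :
  \sum_i (warped_dgamma i i j k - warped_dgamma j i i k
    + \sum_p (warped_gamma i i p * warped_gamma p j k
              - warped_gamma i j p * warped_gamma p i k)) =
  x j * x k * ((2 - N) * (a' - a ^+ 2) - b' + 2 * a * b - b ^+ 2)
  + d j k * (2 * a * h j - nu' j * s - N * nu j - (N * a + b) * h j
      - (N * a + b) * nu j * s + 2 * mu j * nu j * s).
Proof.
under eq_bigr => i _ do rewrite sumrB.
rewrite big_split /= sumrB warped_div warped_dtrace.
rewrite sumrB warped_trace_gamma.
rewrite warped_gamma_sq; ring.
Qed.

End Contraction.

(** * The explicit metric, its Christoffel symbols and its Ricci tensor *)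

Section Metric.
Variables (R : realType) (m : nat).
Implicit Types (u v : 'rV[R]_m.+1) (i j k l p : 'I_m.+1).

Definition coef i : expr R m :=
  if i == ord_max then Inv _ _
  else Mul (Mul (Mul (Log _ _) (Log _ _)) (Mul (Log _ _) (Log _ _))) (Rat _ _).

Definition gram u : 'M[R]_m.+1 :=
  \matrix_(i, j) ((i == j)%:R * ev (coef i) u).

Lemma ev_coef_gt0 i u : 0 < ev (coef i) u.
Proof.
rewrite /coef; case: ifP => _; first exact: inv_log_gt0.
have h := log_s_gt0 u; have h' := rat_s_gt0 u.
change (0 < log_s u * log_s u * (log_s u * log_s u) * rat_s u).
by rewrite !mulr_gt0.
Qed.

Lemma smooth_gram U i j : smooth_on U (fun u => gram u i j).
Proof.
rewrite (_ : (fun u => _) = ev (Mul (Cst _ (i == j)%:R) (coef i))).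
  exact: smooth_ev.
by apply/funext => u; rewrite mxE.
Qed.

Lemma gram_sym u : (gram u)^T = gram u.
Proof.
apply/matrixP => i j; rewrite !mxE eq_sym.
by case: eqP => [->|]; rewrite ?mul0r.
Qed.

Lemma quad_diag (a : 'I_m.+1 -> R) (A : 'M[R]_m.+1) v :
  (forall i j, A i j = (i == j)%:R * a i) ->
  (v *m A *m v^T) 0 0 = \sum_i a i * v 0 i ^+ 2.
Proof.
move=> AE; rewrite mxE; apply: eq_bigr => i _.
rewrite !mxE (bigD1 i) //= AE eqxx mul1r big1 ?addr0; first by ring.
by move=> j /negbTE ji; rewrite AE ji mul0r mulr0.
Qed.

Lemma quad_gram u v :
  (v *m gram u *m v^T) 0 0 = \sum_i ev (coef i) u * v 0 i ^+ 2.
Proof. by apply: quad_diag => i j; rewrite mxE. Qed.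

Lemma gram_posdef u v : v != 0 -> 0 < (v *m gram u *m v^T) 0 0.
Proof.
move=> /rV0Pn [i vi]; rewrite quad_gram (bigD1 i) //=.
apply: ltr_pwDl; first by rewrite mulr_gt0 ?ev_coef_gt0 // exprn_even_gt0.
by apply: sumr_ge0 => j _; rewrite mulr_ge0 ?sqr_ge0 // ltW ?ev_coef_gt0.
Qed.

Lemma invmx_gram u i j :
  invmx (gram u) i j = (i == j)%:R * (ev (coef i) u)^-1.
Proof.
pose B : 'M[R]_m.+1 := \matrix_(i, j) ((i == j)%:R * (ev (coef i) u)^-1).
have AB : gram u *m B = 1%:M.
  apply/matrixP => a b; rewrite !mxE (bigD1 a) //= !mxE eqxx mul1r big1 ?addr0.
    by rewrite mulrCA divff ?mulr1 // gt_eqF // ev_coef_gt0.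
  by move=> c ca; rewrite !mxE eq_sym (negbTE ca) !mul0r.
have uA : gram u \in unitmx by have [] := mulmx1_unit AB.
have -> : invmx (gram u) = B by rewrite -[B](mulKmx uA) AB mulmx1.
by rewrite mxE.
Qed.

(* The logarithmic derivatives in [sq] of the metric coefficients: [alpha_e] for
   the horizontal ones, [beta_e] for the vertical one. *)
Definition alpha_e : expr R m :=
  Mul (Add (Cst _ (-1)) (Mul (Cst _ 4) (Inv _ _))) (Rat _ _).
Definition beta_e : expr R m := Mul (Cst _ (-1)) (Mul (Inv _ _) (Rat _ _)).
Definition inv2_e : expr R m := Mul (Inv _ _) (Inv _ _).
Definition mu_e i := if i == ord_max then beta_e else alpha_e.
(** With Y = [inv_log] and D = [rat_s], the vertical value is $-YD$ times the ratio $Y / (Y^{-4} D)$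
    of vertical to horizontal coefficient, that is $-Y^6$. *)
Definition nu_e i := if i == ord_max then
    Mul (Cst _ (-1)) (Mul inv2_e (Mul inv2_e inv2_e)) else alpha_e.

Definition gamma_e k i j : expr R m :=
  Add (Add (Mul (Cst _ (j == k)%:R) (Mul (mu_e k) (Coord _ i)))
           (Mul (Cst _ (i == k)%:R) (Mul (mu_e k) (Coord _ j))))
      (Mul (Cst _ (-1)) (Mul (Cst _ (i == j)%:R) (Mul (nu_e i) (Coord _ k)))).

(* Primes denote 2 d/ds where s = |x|^2, so that d_l f = f' x_l. *)
Definition alpha' u : R :=
  2 * rat_s u ^+ 2 * (1 - 4 * inv_log u - 4 * inv_log u ^+ 2).
Definition beta' u : R := 2 * rat_s u ^+ 2 * (inv_log u + inv_log u ^+ 2).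
Definition mu' u i : R := if i == ord_max then beta' u else alpha' u.
Definition nu' u i : R :=
  if i == ord_max then 12 * inv_log u ^+ 7 * rat_s u else alpha' u.

Lemma hx_max u : hx ord_max u = 0.
Proof. by rewrite /hx /hor eqxx mul0r. Qed.

Lemma partial_coef i k u :
  partial i (ev (coef k)) u = 2 * ev (mu_e k) u * ev (coef k) u * hx i u.
Proof.
rewrite partial_ev /coef /mu_e; case: ifP => _.
  change (-2 * hx i u * rat_s u * (inv_log u * inv_log u) =
    2 * (-1 * (inv_log u * rat_s u)) * inv_log u * hx i u).
  by ring.
set X := log_s u; set D := rat_s u; set Y := inv_log u.
pose dX := 2 * hx i u * D.
change (((dX * X + X * dX) * (X * X) + (X * X) * (dX * X + X * dX)) * D
   + (X * X * (X * X)) * (-2 * hx i u * (D * D))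
   = 2 * ((-1 + 4 * Y) * D) * (X * X * (X * X) * D) * hx i u).
have YX : Y * X = 1 by rewrite mulVf // gt_eqF // log_s_gt0.
(* The sides agree only modulo [Y * X = 1]; the explicit factor 1 marks the place of that
   product. *)
apply: (@etrans _ _ (8 * 1 * X ^+ 3 * D ^+ 2 * hx i u - 2 * X ^+ 4 * D ^+ 2 * hx i u)).
  by rewrite /dX; ring.
transitivity (8 * (Y * X) * X ^+ 3 * D ^+ 2 * hx i u - 2 * X ^+ 4 * D ^+ 2 * hx i u).
  by rewrite YX.
by ring.
Qed.

Lemma christoffelE k i j : christoffel gram k i j = ev (gamma_e k i j).
Proof.
apply/funext => u; rewrite /christoffel.
have pE a b c : partial a (fun w => gram w b c) u
    = (b == c)%:R * (2 * ev (mu_e b) u * ev (coef b) u * hx a u).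
  rewrite (_ : (fun w => _) = (b == c)%:R *: (ev (coef b) : _ -> R)); last first.
    by apply/funext => w; rewrite mxE.
  rewrite /partial deriveZ; last exact/diff_derivable/differentiable_ev.
  by congr (_ * _); apply: partial_coef.
under eq_bigr do rewrite !pE invmx_gram.
rewrite (bigD1 k) //= eqxx mul1r big1 ?addr0; last first.
  by move=> l /negbTE lk; rewrite eq_sym lk !mul0r.
have ak := ev_coef_gt0 k u.
transitivity ((j == k)%:R * (ev (mu_e k) u * hx i u) +
    (i == k)%:R * (ev (mu_e k) u * hx j u) +
    (-1) * ((i == j)%:R * (ev (nu_e i) u * hx k u))); last by [].
have e1 a b : (a == k)%:R * (2 * ev (mu_e a) u * ev (coef a) u * b) =
    ev (coef k) u * 2 * ((a == k)%:R * (ev (mu_e k) u * b)).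
  by case: eqP => [->|]; [ring|rewrite !mul0r mulr0].
(* This is $\nu_i x_k = (g_{ii} / g_{kk}) \partial_k u_i$ cleared of denominators. For vertical [k]
   both sides vanish; for vertical [i] the powers of [log_s] cancel by [YX]. *)
have e2 : ev (mu_e i) u * ev (coef i) u * hx k u =
    ev (coef k) u * (ev (nu_e i) u * hx k u).
  have [->|kv] := eqVneq k ord_max; first by rewrite hx_max !mulr0.
  rewrite mulrA; congr (_ * _); rewrite /mu_e /nu_e /coef (negbTE kv).
  case: (i == ord_max); last by rewrite mulrC.
  set X := log_s u; set D := rat_s u; set Y := inv_log u.
  change ((-1 * (Y * D)) * Y
    = (X * X * (X * X) * D) * (-1 * (Y * Y * (Y * Y * (Y * Y))))).
  have YX : Y * X = 1 by rewrite mulVf // gt_eqF // log_s_gt0.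
  transitivity (- (Y * X) ^+ 4 * Y ^+ 2 * D); last by ring.
  by rewrite YX; ring.
have e3 : 2 * ev (mu_e i) u * ev (coef i) u * hx k u =
    ev (coef k) u * 2 * (ev (nu_e i) u * hx k u).
  transitivity (2 * (ev (mu_e i) u * ev (coef i) u * hx k u)); first by ring.
  by rewrite e2; ring.
rewrite !e1 e3.
by field; rewrite gt_eqF.
Qed.

Lemma gammaE u k i j : ev (gamma_e k i j) u =
  warped_gamma (fun i => hx i u) (fun i => ev (mu_e i) u) (fun i => ev (nu_e i) u) k i j.
Proof.
rewrite /warped_gamma -mulN1r.
by [].
Qed.

Lemma ev_dmu u l i : ev (dexpr l (mu_e i)) u = mu' u i * hx l u.
Proof.
rewrite /mu_e /mu'; case: ifP => _.
  set D := rat_s u; set Y := inv_log u; set z := hx l u.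
  change (0 * (Y * D) + -1 * ((-2 * z * D * (Y * Y)) * D
     + Y * (-2 * z * (D * D))) = beta' u * z).
  by rewrite /beta' -/D -/Y; ring.
set D := rat_s u; set Y := inv_log u; set z := hx l u.
change ((0 + (0 * Y + 4 * (-2 * z * D * (Y * Y)))) * D
   + (-1 + 4 * Y) * (-2 * z * (D * D)) = alpha' u * z).
by rewrite /alpha' -/D -/Y; ring.
Qed.

Lemma ev_dnu u l i : ev (dexpr l (nu_e i)) u = nu' u i * hx l u.
Proof.
have := ev_dmu u l i; rewrite /mu_e /mu' /nu_e /nu'; case: ifP => // _ _.
set D := rat_s u; set Y := inv_log u; set z := hx l u.
pose dY := -2 * z * D * (Y * Y).
pose dY2 := dY * Y + Y * dY.
change (0 * (Y * Y * (Y * Y * (Y * Y))) + -1 *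
   (dY2 * (Y * Y * (Y * Y)) + Y * Y * (dY2 * (Y * Y) + Y * Y * dY2))
   = 12 * Y ^+ 7 * D * z).
by rewrite /dY2 /dY; ring.
Qed.

Lemma dgammaE u l k i j : partial l (ev (gamma_e k i j)) u =
  warped_dgamma (fun i => hx i u) (@hor R m) (fun i => ev (mu_e i) u)
    (fun i => ev (nu_e i) u) (mu' u) (nu' u) l k i j.
Proof.
rewrite partial_ev /warped_dgamma.
pose dm a c := ev (dexpr l (mu_e a)) u * hx c u
  + ev (mu_e a) u * (hor R c * (l == c)%:R).
pose dn a c := ev (dexpr l (nu_e a)) u * hx c u
  + ev (nu_e a) u * (hor R c * (l == c)%:R).
change (0 * (ev (mu_e k) u * hx i u) + (j == k)%:R * dm k i +
  (0 * (ev (mu_e k) u * hx j u) + (i == k)%:R * dm k j) +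
  (0 * ((i == j)%:R * (ev (nu_e i) u * hx k u)) + -1 *
    (0 * (ev (nu_e i) u * hx k u) + (i == j)%:R * dn i k)) =
  (j == k)%:R *
    (mu' u k * hx l u * hx i u + ev (mu_e k) u * (hor R i * (l == i)%:R)) +
  (i == k)%:R *
    (mu' u k * hx l u * hx j u + ev (mu_e k) u * (hor R j * (l == j)%:R)) -
  (i == j)%:R *
    (nu' u i * hx l u * hx k u + ev (nu_e i) u * (hor R k * (l == k)%:R))).
by rewrite /dm /dn !ev_dmu !ev_dnu; ring.
Qed.

Lemma sum_vert (a b : R) :
  \sum_(i < m.+1) (if i == ord_max then b else a) = m%:R * a + b.
Proof.
rewrite (bigD1 ord_max) //= eqxx addrC; congr (_ + _).
rewrite (eq_bigr (fun=> a)); last by move=> i /negbTE ->.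
by rewrite sumr_const cardC1 card_ord /= mulr_natl.
Qed.

Definition alpha u : R := ev alpha_e u.
Definition beta u : R := ev beta_e u.

Definition ricP u : R :=
  (2 - m%:R) * (alpha' u - alpha u ^+ 2) - beta' u + 2 * alpha u * beta u
  - beta u ^+ 2.

Definition ricQ u j : R :=
  2 * alpha u * hor R j - nu' u j * sq u - m%:R * ev (nu_e j) u
  - (m%:R * alpha u + beta u) * hor R j
  - (m%:R * alpha u + beta u) * ev (nu_e j) u * sq u
  + 2 * ev (mu_e j) u * ev (nu_e j) u * sq u.

Lemma ricciE u j k : ricci gram u j k =
  hx j u * hx k u * ricP u + (j == k)%:R * ricQ u j.
Proof.
rewrite mxE.
under eq_bigr => i _.
  rewrite /riemann !christoffelE !dgammaE.
  under eq_bigr => p _ do rewrite !christoffelE !gammaE.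
  over.
(* The side conditions hold because [hx] and [hor] vanish at [ord_max]; the trace conditions are
   instances of [sum_vert]. *)
apply: warped_ricci => [i|i|i|i|i|i|||||].
- rewrite /mu_e; case: eqP => [->|] //; by rewrite hx_max !mulr0.
- rewrite /nu_e; case: eqP => [->|] //; by rewrite hx_max !mulr0.
- rewrite /mu'; case: eqP => [->|] //; by rewrite hx_max !mulr0.
- rewrite /nu'; case: eqP => [->|] //; by rewrite hx_max !mulr0.
- rewrite /mu_e; case: eqP => [->|] //; by rewrite /hor eqxx !mulr0.
- rewrite /nu_e; case: eqP => [->|] //; by rewrite /hor eqxx !mulr0.
- transitivity (\sum_(i < m.+1) (if i == ord_max then 0 else 1 : R)).
    by apply: eq_bigr => i _; rewrite /hor; case: ifP.
  by rewrite sum_vert mulr1 addr0.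
- by [].
- rewrite -sum_vert; apply: eq_bigr => i _; rewrite /mu_e; by case: ifP.
- rewrite -sum_vert; apply: eq_bigr => i _; rewrite /mu_e; by case: ifP.
- by rewrite -sum_vert.
Qed.

End Metric.

(** * Positivity of the Ricci curvature *)

Lemma sum_sqr_mul_le (R : realFieldType) (n : nat) (a b : 'I_n -> R) :
  (\sum_i a i * b i) ^+ 2 <= (\sum_i a i ^+ 2) * (\sum_i b i ^+ 2).
Proof.
set A := \sum_i a i ^+ 2; set B := \sum_i b i ^+ 2; set C := \sum_i a i * b i.
(* Cauchy-Schwarz: this multiple of the defect is a sum of squares. If [A] is zero then all [a i]
   vanish; otherwise [A] is divided out. *)
have key : 0 <= A * (A * B - C ^+ 2).
  have -> : A * (A * B - C ^+ 2) = \sum_i (A * b i - C * a i) ^+ 2.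
    transitivity (\sum_i (A ^+ 2 * b i ^+ 2 - 2 * A * C * (a i * b i)
      + C ^+ 2 * a i ^+ 2)); last by apply: eq_bigr => i _; ring.
    rewrite big_split sumrB /= -!mulr_sumr -/A -/B -/C; ring.
  by apply: sumr_ge0 => i _; apply: sqr_ge0.
have A0 : 0 <= A by apply: sumr_ge0 => i _; apply: sqr_ge0.
have [Az|An] := eqVneq A 0.
  have a0 i : a i = 0.
    apply/eqP; rewrite -sqrf_eq0; apply/eqP.
    by move/psumr_eq0P : Az; apply => // j _; apply: sqr_ge0.
  by rewrite /C big1 ?Az ?expr0n ?mul0r // => i _; rewrite a0 mul0r.
by rewrite -subr_ge0 -(pmulr_rge0 _ (_ : 0 < A)) // lt_def An.
Qed.

(** Up to the factor [rat_s], the Ricci coefficient on horizontal vectors orthogonal to the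
    position. Here [N] is the number of horizontal dimensions, [Y] is [inv_log] and [d] is $s / (1 +
    s)$. *)
Lemma ric_sphere_gt0 (R : realFieldType) (N Y d : R) :
  3 <= N -> 0 < Y -> 8 * Y <= 1 -> 0 <= d -> d < 1 ->
  0 < (2 * N - 2) * (1 - 4 * Y) + Y - d * (2 * (1 - 4 * Y - 4 * Y ^+ 2)
      + (N - 2) * (1 - 4 * Y) ^+ 2 + Y * (1 - 4 * Y)).
Proof.
move=> N3 Y0 Y8 d0 d1.
(* The expression is expanded about [N = 3], and the remainder about [d = 1]. *)
have -> : (2 * N - 2) * (1 - 4 * Y) + Y - d * (2 * (1 - 4 * Y - 4 * Y ^+ 2)
      + (N - 2) * (1 - 4 * Y) ^+ 2 + Y * (1 - 4 * Y)) =
  (N - 3) * ((1 - 4 * Y) * (2 - d * (1 - 4 * Y))) +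
  (1 - 4 * Y ^+ 2 + (1 - d) * (3 - 15 * Y + 4 * Y ^+ 2)) by ring.
have Y2 : 8 * Y ^+ 2 <= Y by nra.
have Y20 := sqr_ge0 Y.
have h1 : 0 <= (N - 3) * ((1 - 4 * Y) * (2 - d * (1 - 4 * Y))).
  rewrite mulr_ge0 ?subr_ge0 // mulr_ge0 //; first by lra.
  by rewrite subr_ge0; nra.
have h2 : 0 <= (1 - d) * (3 - 15 * Y + 4 * Y ^+ 2).
  by rewrite mulr_ge0 //; lra.
lra.
Qed.

(** The radial direction is the tightest: at [d = 1] the expression equals $(8N - 15) Y^2$, so only
    second-order terms in [Y] survive. *)
Lemma ric_radial_gt0 (R : realFieldType) (N Y d : R) :
  3 <= N -> 0 < Y -> 8 * Y <= 1 -> 0 <= d -> d < 1 ->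
  0 < (N - 3) * (2 * (1 - 4 * Y) - 2 * d * (1 - 4 * Y - 4 * Y ^+ 2))
      + ((1 - d) * (4 - 15 * Y) + 9 * d * Y ^+ 2).
Proof.
move=> N3 Y0 Y8 d0 d1.
have Y20 := sqr_ge0 Y.
have h1 : 0 <= (N - 3) * (2 * (1 - 4 * Y) - 2 * d * (1 - 4 * Y - 4 * Y ^+ 2)).
  rewrite mulr_ge0 ?subr_ge0 //.
  have p1 : 0 <= (1 - d) * (1 - 4 * Y) by rewrite mulr_ge0 //; lra.
  have p2 : 0 <= d * Y ^+ 2 by rewrite mulr_ge0.
  by lra.
have h2 : 0 < (1 - d) * (4 - 15 * Y) by rewrite mulr_gt0 //; lra.
have h3 : 0 <= 9 * d * Y ^+ 2 by rewrite mulr_ge0 // mulr_ge0.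
lra.
Qed.

(** The vertical direction, up to the factor $Y^6$. At [d = 1] the value is $(4N - 11) Y$, which is
    why three horizontal dimensions are required. *)
Lemma ric_vertical_gt0 (R : realFieldType) (N Y d : R) :
  3 <= N -> 0 < Y -> 8 * Y <= 1 -> 0 <= d -> d < 1 ->
  0 < (N - 3) * (1 - d * (1 - 4 * Y)) + (3 - d * (3 - Y)).
Proof.
move=> N3 Y0 Y8 d0 d1.
have h1 : 0 <= (N - 3) * (1 - d * (1 - 4 * Y)).
  rewrite mulr_ge0 ?subr_ge0 //.
  have p1 : 0 <= (1 - d) * (1 - 4 * Y) by rewrite mulr_ge0 //; lra.
  by lra.
have dY : 0 <= d * Y by rewrite mulr_ge0 // ltW.
by lra.
Qed.

Section RicciGram.
Variables (R : realType) (m : nat).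
Hypothesis m3 : (3 <= m)%N.
Implicit Types (u v : 'rV[R]_m.+1).

Let d u := sq u * rat_s u.

Lemma rat_sE u : rat_s u = 1 - d u.
Proof. by rewrite /d /rat_s; field; rewrite gt_eqF // sq1_gt0. Qed.

Lemma sq_rat_ge0 u : 0 <= d u.
Proof. by rewrite mulr_ge0 ?sq_ge0 // ltW ?rat_s_gt0. Qed.

Lemma sq_rat_lt1 u : d u < 1.
Proof. by rewrite -subr_gt0 -rat_sE rat_s_gt0. Qed.

Lemma inv_log_le u : 8 * inv_log u <= 1.
Proof. by rewrite ler_pdivrMr ?mul1r ?log_s_ge8 ?log_s_gt0. Qed.

Let m3R : 3 <= m%:R :> R.
Proof. by rewrite ler_nat. Qed.

Lemma alphaE u : alpha u = - (1 - 4 * inv_log u) * rat_s u.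
Proof.
transitivity ((-1 + 4 * inv_log u) * rat_s u); first by [].
by ring.
Qed.

Lemma betaE u : beta u = - inv_log u * rat_s u.
Proof.
transitivity (-1 * (inv_log u * rat_s u)); first by [].
by ring.
Qed.

Lemma ricQ_hor_gt0 u j : j != ord_max -> 0 < ricQ u j.
Proof.
move=> jm; rewrite /ricQ /nu' /nu_e /mu_e /hor (negbTE jm) -/(alpha u) /=.
rewrite alphaE betaE /alpha'.
have := ric_sphere_gt0 m3R (inv_log_gt0 u) (inv_log_le u) (sq_rat_ge0 u) (sq_rat_lt1 u).
move/(mulr_gt0 (rat_s_gt0 u)); congr (0 < _).
by rewrite /d; ring.
Qed.

(** On the horizontal position vector the rank-one part of the Ricci tensor contributes
    [ricP u * sq u]. *)
Lemma ricQ_ricP_gt0 u j : j != ord_max -> 0 < ricQ u j + ricP u * sq u.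
Proof.
move=> jm; rewrite /ricQ /nu' /nu_e /mu_e /hor (negbTE jm) -/(alpha u) /=.
rewrite /ricP alphaE betaE /alpha' /beta'.
have := ric_radial_gt0 m3R (inv_log_gt0 u) (inv_log_le u) (sq_rat_ge0 u) (sq_rat_lt1 u).
move/(mulr_gt0 (rat_s_gt0 u)); congr (0 < _).
by rewrite /d; ring.
Qed.

Lemma ricQ_vert_gt0 u : 0 < ricQ u ord_max.
Proof.
have nuE : ev (nu_e R ord_max) u = - inv_log u ^+ 6.
  rewrite /nu_e eqxx.
  transitivity (-1 * (inv_log u * inv_log u * (inv_log u * inv_log u * (inv_log u * inv_log u)))) => //.
  by ring.
have muE : ev (mu_e R ord_max) u = beta u by rewrite /mu_e eqxx.
have horE : hor R (@ord_max m) = 0 by rewrite /hor eqxx.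
rewrite /ricQ nuE muE horE /nu' eqxx.
rewrite alphaE betaE.
have := ric_vertical_gt0 m3R (inv_log_gt0 u) (inv_log_le u) (sq_rat_ge0 u) (sq_rat_lt1 u).
have Y6 : 0 < inv_log u ^+ 6 by rewrite exprn_gt0 // inv_log_gt0.
move/(mulr_gt0 Y6); congr (0 < _).
by rewrite /d; ring.
Qed.

(** The form is $P S^2 + Q W + Q_v v_{max}^2$, with $S^2 \le s W$ by Cauchy-Schwarz. Its horizontal
    part is at least $Q W$ if $P \ge 0$ and at least $(Q + s P) W$ if $P < 0$. *)
Lemma ricci_gram_posdef u v : v != 0 -> 0 < (v *m ricci (@gram R m) u *m v^T) 0 0.
Proof.
move=> v0.
pose S := \sum_j hx j u * v 0 j.
pose W := \sum_(j | j != ord_max) v 0 j ^+ 2.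
pose j0 : 'I_m.+1 := ord0.
have j0m : j0 != ord_max by rewrite -val_eqE /= eq_sym -lt0n (leq_trans _ m3).
have QE j : j != ord_max -> ricQ u j = ricQ u j0.
  by move=> jm; rewrite /ricQ /nu' /nu_e /mu_e /hor (negbTE jm) (negbTE j0m).
have -> : (v *m ricci (@gram R m) u *m v^T) 0 0 =
    ricP u * S ^+ 2 + ricQ u j0 * W + ricQ u ord_max * v 0 ord_max ^+ 2.
  pose A : 'M[R]_m.+1 := \matrix_(i, j) (hx i u * hx j u * ricP u).
  pose B : 'M[R]_m.+1 := \matrix_(i, j) ((i == j)%:R * ricQ u i).
  have -> : ricci (@gram R m) u = A + B.
    by apply/matrixP => i j; rewrite ricciE !mxE.
  rewrite mulmxDr mulmxDl [LHS]mxE -addrA; congr (_ + _).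
    have vA i : (v *m A) 0 i = S * (hx i u * ricP u).
      by rewrite mxE /S mulr_suml; apply: eq_bigr => j _; rewrite mxE; ring.
    transitivity (ricP u * S * S); last by ring.
    rewrite mxE {2}/S mulr_sumr; apply: eq_bigr => i _.
    by rewrite vA mxE; ring.
  rewrite (quad_diag (a := ricQ u)); last by move=> i j; rewrite mxE.
  rewrite (bigD1 ord_max) //= addrC; congr (_ + _).
  rewrite /W mulr_sumr; apply: eq_bigr => j jm; by rewrite QE.
have SW : S ^+ 2 <= sq u * W.
  have -> : S = \sum_j hx j u * (hor R j * v 0 j).
    apply: eq_bigr => j _; rewrite /hx /hor.
    by case: (j != _); rewrite ?mul0r ?mul1r // mul0r.
  apply: le_trans (sum_sqr_mul_le _ _) _; rewrite ler_wpM2l ?sq_ge0 //.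
  rewrite (bigD1 ord_max) //= /hor eqxx mul0r expr0n add0r.
  by apply: ler_sum => j -> /=; rewrite mul1r.
have W0 : 0 <= W by apply: sumr_ge0 => j _; apply: sqr_ge0.
have Qb := ricQ_hor_gt0 u j0m; have Qs := ricQ_ricP_gt0 u j0m.
have Qv := ricQ_vert_gt0 u.
(* The equality case is recorded too: if the vertical entry of [v] vanishes, the form can only
   vanish for [W = 0], hence for [v = 0]. *)
have low : 0 <= ricP u * S ^+ 2 + ricQ u j0 * W ?= iff (W == 0).
  apply/leifP; case: eqP => [Wz|/eqP Wn].
    have Sz : S ^+ 2 = 0.
      by apply/eqP; rewrite eq_le sqr_ge0 andbT (le_trans SW) // Wz mulr0.
    by rewrite Sz Wz !mulr0 addr0.
  have Wp : 0 < W by rewrite lt_def Wn.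
  have [P0|P0] := leP 0 (ricP u).
    by rewrite ltr_wpDl ?mulr_gt0 // mulr_ge0 // sqr_ge0.
  apply: (@lt_le_trans _ _ ((ricQ u j0 + ricP u * sq u) * W)).
    by rewrite mulr_gt0.
  rewrite mulrDl addrC lerD2r -mulrA ler_wnM2l // ltW //.
have [lo lo_eq] := low.
have [v1|v1] := eqVneq (v 0 ord_max) 0; last first.
  by rewrite ltr_wpDl // mulr_gt0 // exprn_even_gt0.
rewrite v1 expr0n mulr0 addr0 lt_def lo andbT eq_sym lo_eq.
apply: contra v0 => /eqP W0'; apply/eqP/rowP => j; rewrite mxE.
have [->//|jm] := eqVneq j ord_max.
apply/eqP; rewrite -sqrf_eq0; apply/eqP.
by move/psumr_eq0P : W0'; apply => // i _; apply: sqr_ge0.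
Qed.

End RicciGram.

(** * The warped metric as a Riemannian manifold on row vectors *)

Lemma rV_second_countable (R : realType) n : @second_countable 'rV[R]_n.
Proof.
(* The basis consists of balls with rational centres and radii $1 / (k + 1)$; a radius below [e / 2]
   keeps such a ball inside the given one. *)
pose f (qk : 'rV[rat]_n * nat) : set 'rV[R]_n :=
  ball (map_mx (@ratr R) qk.1) (qk.2.+1%:R^-1).
exists (range f).
  exact: sub_countable (card_image_le _ _) (countableP _).
split=> [_ [[q k] _ <-]|x A /nbhs_ballP [e /= e0 xeA]].
  by apply: ball_open; rewrite invr_gt0.
have [k ke] : exists k, k.+1%:R^-1 < e / 2.
  have e20 : 0 < e / 2 by rewrite divr_gt0.
  near \oo => k; exists k.
  by near: k; exact: near_infty_natSinv_lt (PosNum e20).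
pose r : R := k.+1%:R^-1.
have r0 : 0 < r by rewrite invr_gt0.
have /choice [q qP] j : exists q, x 0 j - r < ratr q < x 0 j + r.
  have /rat_in_itvoo [q] : x 0 j - r < x 0 j + r by rewrite ltrBlDr -addrA ltrDl addr_gt0.
  by rewrite in_itv; exists q.
have qx j : `|ratr (q j) - x 0 j| < r by rewrite ltr_distl.
exists (f (\row_j q j, k)) => /=.
  split; first by exists (\row_j q j, k).
  split=> // i j; rewrite !mxE ord1; exact: qx.
move=> y [_ fy]; apply: xeA; split=> // i j.
have := fy i j; rewrite !mxE /ball /= => yq; rewrite (ord1 i) in yq *.
rewrite -(subrKA (ratr (q j))) (le_lt_trans (ler_normD _ _)) // [ltRHS]splitr.
rewrite ltrD // (lt_trans _ ke) //.
by rewrite distrC.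
Unshelve. all: by end_near. Qed.

Lemma rV_connected (R : realType) n : connected [set: 'rV[R]_n].
Proof.
have -> : [set: 'rV[R]_n] =
    \bigcup_(x in [set: 'rV[R]_n]) ((fun t : R => t *: x) @` `[0, 1]).
  apply/seteqP; split=> // x _; exists x => //; exists 1; last by rewrite scale1r.
  by rewrite /= in_itv /= ler01 lexx.
apply: bigcup_connected.
  exists 0 => x _; exists 0; last by rewrite scale0r.
  by rewrite /= in_itv /= ler01 lexx.
move=> x _; apply: connected_continuous_connected; first exact: segment_connected.
by apply: continuous_subspaceT => t; apply: scalel_continuous.
Qed.

Section Manifold.
Variables (R : realType) (m : nat).
Local Notation V := 'rV[R]_m.+1.

(** The vertical coordinate lies outside the algebra of expressions, whose [Coord] is horizontal,
    but its partial derivatives are constants. *)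
Lemma smooth_coord U (b : 'I_m.+1) : smooth_on U (fun u : V => u 0 b).
Proof.
have df u : differentiable (fun u : V => u 0 b) u.
  exact: (@differentiable_coord R 1 m.+1).
have pE l : partial l (fun u : V => u 0 b) = ev (Cst m (l == b)%:R).
  by apply/funext => u; rewrite partial_coord.
case=> [|k]; split=> //; try by move=> x _; exact/differentiable_continuous/df.
move=> j; split; first by move=> x _; exact/diff_derivable/df.
by rewrite pE; apply: smooth_ev.
Qed.

(** One global chart, the identity. [Defined] keeps the record transparent, so that points can be
    used as row vectors. *)
Definition coordinate_space : smooth_manifold R m.+1.
Proof.
refine (@SmoothManifold R m.+1 V _ (@rV_second_countable R m.+1) (@rV_connected R m.+1)
  unit (fun=> setT) (fun=> id) (fun=> id) (fun=> tt) _ _ _ _ _ _ _) => //.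
- by move=> _; exact: openT.
- by move=> _; rewrite image_id; exact: openT.
- by move=> _ x _; exact: cvg_id.
- by move=> _ x _; exact: cvg_id.
- move=> _ _ b; exact: smooth_coord.
Defined.

Lemma jacobian_id (x : V) : 'J (fun u : V => u) x = 1%:M.
Proof.
apply/row_matrixP => i; rewrite !rowE mulmx1 -deriveEjacobian; last first.
  exact: ex_diff.
exact: derive_id.
Qed.

Definition warped : riemannian_manifold R m.+1.
Proof.
refine (@RiemannianManifold R m.+1 coordinate_space (fun=> @gram R m) _ _ _ _).
- by move=> i a b; apply: smooth_gram.
- by move=> i u _; apply: gram_sym.
- by move=> i u v _; apply: gram_posdef.
- move=> [] [] x _ _ /=.
  by rewrite (jacobian_id x) trmx1 mulmx1 mul1mx.
Defined.

Lemma warped_positive_ricci : (3 <= m)%N -> positive_ricci warped.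
Proof. by move=> m3 i u v _; apply: ricci_gram_posdef. Qed.

End Manifold.

(** * Lengths and distances *)

Section Curves.
Variables (R : realType) (m : nat).
Local Notation V := 'rV[R]_m.+1.
Local Notation N := (warped R m).
Local Notation mu := (@lebesgue_measure R).
Implicit Types (c : R -> N) (t : R).

Lemma C1_curveP c : C1_curve c <-> forall t, 0 <= t <= 1 ->
  (\forall s \near t, derivable (c : R -> V) s 1) /\
  {for t, continuous (derive1 (c : R -> V))}.
Proof.
split=> cC1 t t01.
  have [cd cc] := cC1 t t01 tt I; split; last exact: cc.
  by apply: filterS cd => s [].
move=> i _; have [cd cc] := cC1 t t01; split; last exact: cc.
apply: filterS cd => s ds; split; last exact: ds.
by apply/differentiable_continuous/derivable1_diffP.
Qed.

Lemma C1_derivable c t : C1_curve c -> 0 <= t <= 1 -> derivable (c : R -> V) t 1.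
Proof. by move=> /C1_curveP cC1 /cC1 [] /nbhs_singleton. Qed.

Lemma C1_continuous c t : C1_curve c -> 0 <= t <= 1 -> {for t, continuous (c : R -> V)}.
Proof.
by move=> cC1 t01; apply/differentiable_continuous/derivable1_diffP/C1_derivable.
Qed.

Lemma speedE c t : speed c t =
  Num.sqrt (\sum_i ev (coef R i) (c t) * (derive1 (c : R -> V) t) 0 i ^+ 2).
Proof. by rewrite -quad_gram. Qed.

Lemma speed_ge0 c t : 0 <= speed c t.
Proof. exact: sqrtr_ge0. Qed.

Lemma speed_continuous c t : C1_curve c -> 0 <= t <= 1 -> {for t, continuous (speed c)}.
Proof.
move=> cC1 t01.
rewrite (_ : speed c = @Num.sqrt R \o
  (fun t => \sum_i ev (coef R i) (c t) * (derive1 (c : R -> V) t) 0 i ^+ 2)); last first.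
  by apply/funext => s; rewrite speedE.
apply: continuous_comp; last exact: sqrt_continuous.
apply: cvg_big => [|i _]; first exact: add_continuous.
apply: cvgM.
  apply: (@continuous_comp _ _ _ (c : R -> V) (ev (coef R i))).
    exact: C1_continuous.
  exact/differentiable_continuous/differentiable_ev.
apply: (@continuous_comp _ _ _ (fun t => (derive1 (c : R -> V) t) 0 i) (fun x => x ^+ 2)).
  apply: (@continuous_comp _ _ _ (derive1 (c : R -> V)) (fun v : V => v 0 i)).
    by have [_] := (C1_curveP c).1 cC1 t t01.
  exact: coord_continuous.
exact: exprn_continuous.
Qed.

Lemma speed_within c a b : C1_curve c -> 0 <= a -> b <= 1 ->
  {within `[a, b], continuous (speed c)}.
Proof.
move=> cC1 a0 b1; apply: continuous_in_subspaceT => t.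
rewrite inE /= in_itv /= => /andP [at_ tb]; apply: speed_continuous => //.
by rewrite (le_trans a0 at_) (le_trans tb b1).
Qed.

Lemma speed_integrable c a b : C1_curve c -> 0 <= a -> b <= 1 ->
  mu.-integrable `[a, b] (EFin \o speed c).
Proof.
move=> cC1 a0 b1; apply: continuous_compact_integrable; first exact: segment_compact.
exact: speed_within.
Qed.

Definition clen c : R := Rintegral mu `[0, 1] (speed c).

Lemma curve_lengthE c : C1_curve c -> curve_length c = (clen c)%:E.
Proof.
move=> cC1; rewrite /clen /Rintegral fineK //.
apply: integrable_fin_num => //=; exact: speed_integrable.
Qed.

Lemma clen_ge0 c : 0 <= clen c.
Proof. by apply: Rintegral_ge0 => t _; apply: speed_ge0. Qed.

(* Compare the derivatives of [K * \int_0^t speed] and of [psi]. *)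
Lemma clen_lipschitz_le c (psi : R -> R) (K : R) : C1_curve c ->
  (forall t, 0 <= t <= 1 -> derivable psi t 1 /\ derive1 psi t <= K * speed c t) ->
  psi 1 - psi 0 <= K * clen c.
Proof.
move=> cC1 psiP.
pose F x := Rintegral mu `[0, x] (speed c).
have itg := speed_integrable cC1 (lexx 0) (lexx 1).
have F0 : F 0 = 0 by rewrite /F set_itv1 Rintegral_set1.
have FD t : t \in `]0, 1[ -> derivable F t 1 /\ derive1 F t = speed c t.
  rewrite in_itv /= => /andP [t0 t1].
  apply: (continuous_FTC1_closed t1 itg t0).
  by apply: speed_continuous => //; rewrite !ltW.
have ps t : t \in `]0, 1[ -> derivable psi t 1 /\ derive1 psi t <= K * speed c t.
  by rewrite in_itv /= => /andP [t0 t1]; apply: psiP; rewrite !ltW.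
pose G := K *: F - psi.
have GD t : t \in `]0, 1[ -> is_derive t 1 G (K * speed c t - derive1 psi t).
  move=> t01; have [dF FE] := FD t t01; have [dp _] := ps t t01.
  have dKF := @derivableZ R R R F K t 1 dF; have dG := derivableB dKF dp.
  split; first exact: dG.
  by rewrite /G (deriveB dKF dp) (deriveZ K dF) -!derive1E FE.
have Gc : {within `[0, 1], continuous G}.
  move=> x; apply: cvgB.
    apply: cvgZl_tmp; exact: parameterized_integral_continuous.
  apply: continuous_in_subspaceT => t; rewrite inE /= in_itv /= => t01.
  by apply/differentiable_continuous/derivable1_diffP; have [] := psiP t t01.
have : G 0 <= G 1.
  apply: (@ger0_derive1_le_cc R G 0 1) => //.
  - by move=> t t01; have [] := GD t t01.
  - move=> t t01; rewrite derive1E; have [_ ->] := GD t t01.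
    by rewrite subr_ge0; have [] := ps t t01.
  - by rewrite in_itv /= lexx ler01.
  - by rewrite in_itv /= lexx ler01.
rewrite /G /= !fctE F0 /GRing.scale /= mulr0 -/(clen c) /F -/(clen c); lra.
Qed.

Lemma clen_lipschitz c (psi : R -> R) (K : R) : C1_curve c ->
  (forall t, 0 <= t <= 1 -> derivable psi t 1 /\ `|derive1 psi t| <= K * speed c t) ->
  `|psi 1 - psi 0| <= K * clen c.
Proof.
move=> cC1 psiP; rewrite ler_norml lerNl opprB; apply/andP; split.
  have := @clen_lipschitz_le c (- psi) K cC1; rewrite !fctE opprK addrC.
  apply => t t01; have [dp pK] := psiP t t01; split; first exact: derivableN.
  rewrite derive1E deriveN // -derive1E; apply: le_trans pK.
  by rewrite -normrN ler_norm.
apply: clen_lipschitz_le => // t t01; have [dp pK] := psiP t t01; split=> //.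
by apply: le_trans pK; apply: ler_norm.
Qed.

Lemma affine_continuous (a b : R) : continuous (fun t : R => a + b * t).
Proof. by move=> t; apply: cvgD; [exact: cvg_cst|apply: cvgMl_tmp; exact: cvg_id]. Qed.

Lemma near_affine (P : set R) (a b t : R) :
  (\forall s \near a + b * t, P s) -> \forall s \near t, P (a + b * s).
Proof. exact: (@affine_continuous a b t P). Qed.

Lemma is_derive_affine (a b t : R) : is_derive t 1 (fun t : R => a + b * t) b.
Proof.
have := @is_deriveD _ _ _ (cst a) (b *: id) t 1 0 b _ _.
rewrite add0r; apply.
rewrite -[X in is_derive _ _ _ X](mulr1 b); exact: is_deriveZ.
Qed.

Lemma derive1_affine (c : R -> V) (a b t : R) :
  derivable c (a + b * t) 1 ->
  derivable (fun t => c (a + b * t)) t 1 /\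
  derive1 (fun t => c (a + b * t)) t = b *: derive1 c (a + b * t).
Proof.
move=> dc.
have d1 := is_derive_affine a b t.
have D1 : differentiable (fun t : R => a + b * t) t.
  by apply/derivable1_diffP; case: d1.
have D2 : differentiable c (a + b * t) by apply/derivable1_diffP.
have D : differentiable (c \o (fun t : R => a + b * t)) t by apply: differentiable_comp.
split; first by apply/derivable1_diffP.
rewrite derive1E' // diff_comp //= deriv1E // deriv1E //=.
by rewrite scale1r derive1E; case: d1 => _ ->.
Qed.

Lemma C1_affine c a b : C1_curve c -> 0 <= a -> 0 <= b -> a + b <= 1 ->
  C1_curve (fun t => c (a + b * t)).
Proof.
move=> cC1 a0 b0 ab1; apply/C1_curveP => t /andP [t0 t1].
have abt : 0 <= a + b * t <= 1.
  rewrite addr_ge0 ?mulr_ge0 //=; apply: le_trans ab1.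
  by rewrite lerD2l ler_piMr.
have [cd cc] := (C1_curveP c).1 cC1 _ abt.
have cd' := near_affine cd.
split; first by apply: filterS cd' => s /derive1_affine [].
have E : \forall s \near t, b *: derive1 (c : R -> V) (a + b * s) =
    derive1 (fun t => (c : R -> V) (a + b * t)) s.
  by apply: filterS cd' => s /derive1_affine [].
have Et := nbhs_singleton E.
apply: (cvg_trans (near_eq_cvg E)).
rewrite -Et; apply: cvgZl_tmp.
move=> A /cc cA; exact: (near_affine cA).
Qed.

Lemma speed_affine c a b t : 0 <= b -> derivable (c : R -> V) (a + b * t) 1 ->
  speed (fun t => c (a + b * t)) t = b * speed c (a + b * t).
Proof.
move=> b0 /derive1_affine [_ E]; rewrite !speedE /= E.
rewrite -[X in _ = X * _](ger0_norm b0) -sqrtr_sqr -sqrtrM ?sqr_ge0 // mulr_sumr.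
by congr Num.sqrt; apply: eq_bigr => i _; rewrite mxE; ring.
Qed.

Lemma clen_affine c a b : C1_curve c -> 0 <= a -> 0 < b -> a + b <= 1 ->
  clen (fun t => c (a + b * t)) = Rintegral mu `[a, a + b] (speed c).
Proof.
move=> cC1 a0 b0 ab1.
suff int_eq : (\int[mu]_(t in `[0%R, 1%R]) (speed (fun t => c (a + b * t)) t)%:E =
    \int[mu]_(t in `[a, (a + b)%R]) (speed c t)%:E)%E.
  by rewrite /clen /Rintegral int_eq.
pose F t : R := a + b * t.
have F0 : F 0 = a by rewrite /F mulr0 addr0.
have F1 : F 1 = a + b by rewrite /F mulr1.
have dF t : is_derive t 1 F b := is_derive_affine a b t.
have F'E : derive1 F = cst b by apply/funext => t; rewrite derive1E; case: (dF t).
have cF t : {for t, continuous F}.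
  by apply/differentiable_continuous/derivable1_diffP; case: (dF t).
have := @integration_by_substitution_increasing R F (speed c) 0 1 ler01.
rewrite F0 F1 F'E => sub; rewrite sub //.
- apply: eq_integral => t; rewrite inE /= in_itv /= => /andP [t0 t1].
  have bt : b * t <= b by rewrite ler_piMr // ltW.
  have bt0 : 0 <= b * t by rewrite mulr_ge0 // ltW.
  have abt : 0 <= a + b * t <= 1 by apply/andP; split; lra.
  rewrite speed_affine ?(ltW b0) //; last exact: C1_derivable.
  by rewrite fctE /= mulrC.
- by move=> x y _ _ xy; rewrite /F ltrD2l ltr_pM2l.
- by move=> x _; apply: cvg_cst.
- by apply/cvg_ex; exists b; apply: cvg_cst.
- by apply/cvg_ex; exists b; apply: cvg_cst.
- split; first by move=> t _; case: (dF t).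
    by apply: cvg_at_right_filter; apply: cF.
  by apply: cvg_at_left_filter; apply: cF.
- exact: speed_within.
Qed.

(** Both halves are reparametrized affinely by [0, 1], as [piecewise_C1] demands; [0 +] keeps the
    shape of [clen_affine]. *)
Lemma clen_split c a : C1_curve c -> 0 < a < 1 ->
  clen (fun t => c (0 + a * t)) + clen (fun t => c (a + (1 - a) * t)) = clen c.
Proof.
move=> cC1 /andP [a0 a1].
have a1' : 0 < 1 - a by rewrite subr_gt0.
rewrite (clen_affine cC1 (lexx 0) a0) ?add0r ?(ltW a1) //.
rewrite (clen_affine cC1 (ltW a0) a1') ?subrKC //.
have itg := speed_integrable cC1 (lexx 0) (lexx 1).
rewrite -(@Rintegral_itv_obnd_cbnd R a); last first.
  apply: integrableS itg => //; apply: subset_itvr; rewrite bnd_simp; exact: ltW.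
rewrite -(Rintegral_itvB itg) ?bnd_simp ?ltW //.
by rewrite addrC subrK.
Qed.

End Curves.

(** * Real-valued distance and paths *)

Section Distance.
Variables (R : realType) (m : nat).
Local Notation V := 'rV[R]_m.+1.
Local Notation N := (warped R m).
Implicit Types (c : R -> N) (x y z p q : N) (s : seq (R -> N)).

Definition plen s : R := \sum_(c <- s) clen c.

Lemma plen_ge0 s : 0 <= plen s.
Proof. by apply: sumr_ge0 => c _; apply: clen_ge0. Qed.

Lemma plenE x y s : piecewise_C1 x y s ->
  (\sum_(c <- s) curve_length c)%E = (plen s)%:E.
Proof.
rewrite /plen; elim: s x => [|c s IH] x /=; first by rewrite !big_nil.
by case=> cC1 _ /IH; rewrite !big_cons EFinD => ->; rewrite curve_lengthE.
Qed.

Lemma piecewise_cat x y z s s' : piecewise_C1 x y s -> piecewise_C1 y z s' ->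
  piecewise_C1 x z (s ++ s').
Proof.
elim: s x => [|c s IH] x /=; first by move=> ->.
by case=> cC1 c0 /IH h /h.
Qed.

(** The disjunct [x = p] accounts for the point of an empty path. *)
Fixpoint on_path x s p : Prop :=
  x = p \/ (if s is c :: s' then
    (exists t, 0 <= t <= 1 /\ c t = p) \/ on_path (c 1) s' p else False).

Definition seg (a b : V) : R -> N := fun t => a + t *: (b - a).

Lemma seg_derive (a b : V) t :
  derivable (seg a b : R -> V) t 1 /\ derive1 (seg a b : R -> V) t = b - a.
Proof.
suff h : is_derive t 1 (seg a b : R -> V) (b - a).
  by rewrite derive1E; case: h.
have dz : is_derive t 1 (fun t : R => t *: (b - a)) (b - a).
  have [d dE] := @is_diff_scalel R V t (b - a).
  split; first exact: diff_derivable.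
  by rewrite deriveE // dE scale1r.
rewrite -[X in is_derive _ _ _ X]add0r.
exact: (@is_deriveD _ _ _ (cst a)).
Qed.

Lemma C1_seg (a b : V) : C1_curve (seg a b).
Proof.
apply/C1_curveP => t _; split.
  by apply: filterE => s; have [] := seg_derive a b s.
have -> : derive1 (seg a b : R -> V) = cst (b - a).
  by apply/funext => s; have [] := seg_derive a b s.
exact: cvg_cst.
Qed.

Lemma piecewise_seg (a b : N) : piecewise_C1 a b [:: seg a b].
Proof.
split; first exact: C1_seg.
- by rewrite /seg scale0r addr0.
- by rewrite /= /seg scale1r subrKC.
Qed.

(** Nothing is lost by [fine]: straight segments make all distances finite, see [distE]. *)
Definition dd x y : R := fine (dist x y).

Lemma dist_le x y s : piecewise_C1 x y s -> (dist x y <= (plen s)%:E)%E.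
Proof. by move=> xys; apply: ereal_inf_lbound; exists s => //; apply: (plenE xys). Qed.

Lemma dist_ge0 x y : (0 <= dist x y)%E.
Proof.
apply: le_ereal_inf_tmp => _ [s xys <-].
by rewrite (plenE xys) lee_fin plen_ge0.
Qed.

Lemma distE x y : dist x y = (dd x y)%:E.
Proof.
rewrite /dd fineK //; apply/fin_numPlt.
rewrite (lt_le_trans _ (dist_ge0 x y)) ?ltNyr //=.
exact: le_lt_trans (dist_le (piecewise_seg x y)) (ltry _).
Qed.

Lemma dd_le_plen x y s : piecewise_C1 x y s -> dd x y <= plen s.
Proof. by move=> /dist_le; rewrite distE lee_fin. Qed.

Lemma dd_ge0 x y : 0 <= dd x y.
Proof. by have := dist_ge0 x y; rewrite distE lee_fin. Qed.

Lemma dd_approx x y e : 0 < e ->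
  exists s, piecewise_C1 x y s /\ plen s < dd x y + e.
Proof.
move=> e0.
have : (dist x y < (dd x y + e)%:E)%E by rewrite distE lte_fin ltrDl.
move=> /ereal_inf_lt [_ [s xys <-]].
by rewrite (plenE xys) lte_fin; exists s.
Qed.

Lemma dd_ge x y r : (forall s, piecewise_C1 x y s -> r <= plen s) -> r <= dd x y.
Proof.
move=> h; apply/ler_addgt0Pr => e e0.
by have [s [/h rs /ltW se]] := dd_approx x y e0; apply: le_trans se.
Qed.

Lemma dd_refl x : dd x x = 0.
Proof.
apply/eqP; rewrite eq_le dd_ge0 andbT.
by have := @dd_le_plen x x [::] erefl; rewrite /plen big_nil.
Qed.

Lemma dd_triangle y x z : dd x z <= dd x y + dd y z.
Proof.
rewrite -lerBlDr; apply: dd_ge => s xys.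
rewrite lerBlDr addrC -lerBlDr; apply: dd_ge => s' yzs'.
rewrite lerBlDr addrC.
by have := dd_le_plen (piecewise_cat xys yzs'); rewrite /plen big_cat.
Qed.

Lemma dd_split_curve c t : C1_curve c -> 0 <= t <= 1 ->
  dd (c 0) (c t) + dd (c t) (c 1) <= clen c.
Proof.
move=> cC1 /andP [t0 t1].
have dc : dd (c 0) (c 1) <= clen c.
  by have := @dd_le_plen (c 0) (c 1) [:: c] _; rewrite /plen big_seq1; apply.
(* The end points are treated apart because [clen_split] cuts at interior parameters only. *)
have [->|tn0] := eqVneq t 0; first by rewrite dd_refl add0r.
have [->|tn1] := eqVneq t 1; first by rewrite dd_refl addr0.
have t0' : 0 < t by rewrite lt_def tn0.
have t1' : t < 1 by rewrite lt_def eq_sym tn1.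
rewrite -(clen_split cC1 (_ : 0 < t < 1)) ?t0' //.
apply: lerD.
  have := @dd_le_plen (c 0) (c t) [:: fun u => c (0 + t * u)] _.
  rewrite /plen big_seq1; apply; split => /=.
  - by apply: C1_affine => //; rewrite add0r.
  - by rewrite mulr0 addr0.
  - by rewrite mulr1 add0r.
have := @dd_le_plen (c t) (c 1) [:: fun u => c (t + (1 - t) * u)] _.
rewrite /plen big_seq1; apply; split => /=.
- by apply: C1_affine; rewrite ?subr_ge0 // subrKC.
- by rewrite mulr0 addr0.
- by rewrite mulr1 subrKC.
Qed.

(** The piece through [p] is cut at [p]; the triangle inequality absorbs the other pieces. *)
Lemma dd_split x y s p : piecewise_C1 x y s -> on_path x s p ->
  dd x p + dd p y <= plen s.
Proof.
elim: s x => [|c s IH] x /=.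
  by move=> -> [->|//]; rewrite !dd_refl addr0 plen_ge0.
case=> cC1 c0 c1s; rewrite -c0.
have cl := @dd_split_curve c 0 cC1 _.
have d01 : dd (c 0) (c 1) <= clen c.
  by move: cl; rewrite dd_refl add0r lexx ler01; apply.
have ds := dd_le_plen c1s.
rewrite /plen big_cons -/(plen s).
case=> [<-|[[t [t01 <-]]|/(IH _ c1s) h]].
- rewrite dd_refl add0r; apply: le_trans (dd_triangle (c 1) _ _) _; exact: lerD.
- have h := dd_split_curve cC1 t01.
  have := dd_triangle (c 1) (c t) y; lra.
- have := dd_triangle (c 1) (c 0) p; lra.
Qed.

(** The intermediate value theorem is applied to the first piece at whose end [phi] is at least
    [r]. *)
Lemma path_IVT x y s (phi : N -> R) r : piecewise_C1 x y s ->
  continuous (phi : V -> R) -> phi x <= r <= phi y ->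
  exists p, on_path x s p /\ phi p = r.
Proof.
move=> + cphi; elim: s x => [|c s IH] x /=.
  by move=> -> /andP [h1 h2]; exists y; split; [left|apply/eqP; rewrite eq_le h1 h2].
case=> cC1 c0 c1s /andP [xr ry].
have [r1|r1] := leP r (phi (c 1)); last first.
  have [|p [ps pr]] := IH (c 1) c1s; first by rewrite (ltW r1).
  by exists p; split => //; right; right.
have ci : {within `[0, 1], continuous (fun t => phi (c t))}.
  apply: continuous_in_subspaceT => t; rewrite inE /= in_itv /= => t01.
  apply: (@continuous_comp _ _ _ (c : R -> V) (phi : V -> R)); last exact: cphi.
  exact: C1_continuous.
have [|t t01 <-] := @IVT R _ 0 1 r ler01 ci.
  by rewrite c0 ge_min xr /= le_max r1 orbT.
by exists (c t); split => //; right; left; exists t; rewrite in_itv in t01.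
Qed.

(** The predicate [Q] confines the estimate to the region where the path runs; the vertical
    coordinate needs this, its Lipschitz constant depending on a bound for [log_s]. *)
Lemma path_lipschitz (psi : N -> R) K x y s (Q : N -> Prop) :
  (forall c, C1_curve c -> (forall t, 0 <= t <= 1 -> Q (c t)) ->
    `|psi (c 1) - psi (c 0)| <= K * clen c) ->
  piecewise_C1 x y s -> (forall p, on_path x s p -> Q p) ->
  `|psi y - psi x| <= K * plen s.
Proof.
move=> psiK; elim: s x => [|c s IH] x /=.
  by move=> -> _; rewrite subrr normr0 /plen big_nil mulr0.
case=> cC1 c0 c1s sQ.
have h1 : `|psi (c 1) - psi (c 0)| <= K * clen c.
  by apply: psiK => // t t01; apply: sQ; right; left; exists t.
have h2 : `|psi y - psi (c 1)| <= K * plen s.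
  by apply: IH => // p ps; apply: sQ; right; right.
have -> : psi y - psi x = (psi (c 1) - psi (c 0)) + (psi y - psi (c 1)).
  by rewrite c0; ring.
rewrite /plen big_cons mulrDr -/(plen s).
by apply: le_trans (ler_normD _ _) _; exact: lerD.
Qed.

End Distance.

(** * Comparison of the distance with coordinates *)

Section Estimates.
Variables (R : realType) (m : nat).
Local Notation V := 'rV[R]_m.+1.
Local Notation N := (warped R m).
Implicit Types (c : R -> N) (x y z p q : N) (s : seq (R -> N)).

Definition vert (w : R) : V := w *: delta_mx 0 ord_max.

Lemma vert_max w : vert w 0 ord_max = w.
Proof. by rewrite !mxE !eqxx mulr1. Qed.

Lemma vert_hor w i : i != ord_max -> vert w 0 i = 0.
Proof. by move=> /negbTE im; rewrite !mxE im andbF mulr0. Qed.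

Lemma hx_vert i w (u : V) : hx i (u + vert w) = hx i u.
Proof.
rewrite /hx /hor mxE; have [->|im] := eqVneq i ord_max; first by rewrite !mul0r.
by rewrite vert_hor // addr0.
Qed.

Lemma sq_vert w (u : V) : sq (u + vert w) = sq u.
Proof. by apply: eq_bigr => i _; rewrite hx_vert. Qed.

Lemma log_s_vert w (u : V) : log_s (u + vert w) = log_s u.
Proof. by rewrite /log_s sq_vert. Qed.

Lemma coef_vert i w (u : V) : ev (coef R i) (u + vert w) = ev (coef R i) u.
Proof.
rewrite /coef; case: ifP => _; first by rewrite /= /inv_log log_s_vert.
change (log_s (u + vert w) * log_s (u + vert w) *
  (log_s (u + vert w) * log_s (u + vert w)) * rat_s (u + vert w) =
  log_s u * log_s u * (log_s u * log_s u) * rat_s u).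
by rewrite log_s_vert /rat_s sq_vert.
Qed.

(* From [1 + s = exp (ln (1 + s) / 4) ^ 4]. *)
Lemma log_s_pow_le (u : V) : log_s u ^+ 4 * rat_s u <= 8 ^+ 4.
Proof.
rewrite ler_pdivrMr ?sq1_gt0 //.
set L := ln (1 + sq u).
have L0 : 0 <= L by rewrite ln_ge0 // lerDl sq_ge0.
have -> : 1 + sq u = expR (L / 4) ^+ 4.
  rewrite -expRM_natl -{1}[1 + sq u]lnK ?posrE ?sq1_gt0 // -/L.
  by congr expR; rewrite mulrC divfK.
rewrite -exprMn; apply: lerXn2r; rewrite ?nnegrE ?(ltW (log_s_gt0 u)) //.
have := expR_ge1Dx (L / 4); rewrite /log_s -/L; lra.
Qed.

Lemma coef_le i (u : V) : ev (coef R i) u <= 8 ^+ 4.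
Proof.
rewrite /coef; case: ifP => _.
  have := inv_log_le u; rewrite /=; have := inv_log_gt0 u; lra.
change (log_s u * log_s u * (log_s u * log_s u) * rat_s u <= 8 ^+ 4).
have -> : log_s u * log_s u * (log_s u * log_s u) * rat_s u = log_s u ^+ 4 * rat_s u.
  by ring.
exact: log_s_pow_le.
Qed.

Lemma coef_max (u : V) : ev (coef R ord_max) u = inv_log u.
Proof. by rewrite /coef eqxx. Qed.

Lemma ler_coord (v : V) i : `|v 0 i| <= `|v|.
Proof.
rewrite [leRHS]/Num.Def.normr /= mx_normrE.
exact: (le_bigmax _ (fun ij => `|v ij.1 ij.2|) (0, i)).
Qed.

Lemma clen_le c K : C1_curve c -> (forall t, 0 <= t <= 1 -> speed c t <= K) ->
  clen c <= K.
Proof.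
move=> cC1 cK.
have -> : K = Rintegral (@lebesgue_measure R) `[0, 1] (cst K).
  by rewrite Rintegral_cst //= lebesgue_measure_itv /= lte01 sube0 /= mulr1.
apply: le_Rintegral => //.
- exact: speed_integrable.
- apply: continuous_compact_integrable; first exact: segment_compact.
  by apply: continuous_subspaceT => t; apply: cvg_cst.
Qed.

Lemma dd_seg_le x y K :
  (forall t, 0 <= t <= 1 ->
    \sum_i ev (coef R i) (seg x y t) * ((y : V) - x) 0 i ^+ 2 <= K ^+ 2) ->
  0 <= K -> dd x y <= K.
Proof.
move=> h K0; apply: le_trans (dd_le_plen (piecewise_seg x y)) _.
rewrite /plen big_seq1; apply: clen_le; first exact: C1_seg.
move=> t t01; rewrite speedE; have [_ ->] := seg_derive x y t.
by rewrite -(ger0_norm K0) -sqrtr_sqr ler_wsqrtr // h.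
Qed.

(** Each of the [m.+1] metric coefficients is at most $8^4$, which bounds the distance by this
    multiple of the sup norm. *)
Definition norm_const : R := Num.sqrt (8 ^+ 4 * m.+1%:R).

Lemma norm_const_gt0 : 0 < norm_const.
Proof. by rewrite sqrtr_gt0 mulr_gt0 // ltr0n. Qed.

Lemma dd_le_norm x y : dd x y <= norm_const * `|(y : V) - x|.
Proof.
apply: dd_seg_le; last by rewrite mulr_ge0 // ltW // norm_const_gt0.
move=> t _; rewrite exprMn sqr_sqrtr ?mulr_ge0 //.
apply: (@le_trans _ _ (\sum_(i < m.+1) 8 ^+ 4 * `|(y : V) - x| ^+ 2)).
  apply: ler_sum => i _; apply: ler_pM.
  - exact: ltW (ev_coef_gt0 _ _).
  - exact: sqr_ge0.
  - exact: coef_le.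
  - by rewrite -real_normK ?num_real // lerXn2r ?nnegrE // ler_coord.
by rewrite sumr_const card_ord -[_ *+ m.+1]mulr_natr mulrAC.
Qed.

(** The vertical segment has constant speed, since [log_s] is constant along it. *)
Lemma dd_vert x w : dd x ((x : V) + vert w) <= Num.sqrt (inv_log x) * `|w|.
Proof.
apply: dd_seg_le; last by rewrite mulr_ge0 // sqrtr_ge0.
move=> t _; rewrite exprMn sqr_sqrtr ?(ltW (inv_log_gt0 _)) // real_normK ?num_real //.
have vE : (x : V) + vert w - x = vert w by rewrite addrC addKr.
have sE : seg x ((x : V) + vert w) t = (x : V) + vert (t * w).
  by rewrite /seg vE /vert scalerA.
rewrite sE vE (bigD1 ord_max) //= vert_max coef_vert coef_max.
by rewrite big1 ?addr0 // => i im; rewrite vert_hor // expr0n mulr0.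
Qed.

Lemma derive1_translate (c : R -> V) (v : V) t : derivable c t 1 ->
  derivable (fun t => c t + v) t 1 /\ derive1 (fun t => c t + v) t = derive1 c t.
Proof.
move=> dc; have dv : derivable (cst v : R -> V) t 1 by exact: derivable_cst.
split; first exact: (@derivableD _ _ _ c (cst v) t 1 dc dv).
by rewrite !derive1E (@deriveD _ _ _ c (cst v) t 1 dc dv) derive_cst addr0.
Qed.

(** The metric coefficients do not depend on the vertical coordinate, so translating a path
    preserves its length. *)
Lemma dd_vert_translate x y w :
  dd ((x : V) + vert w) ((y : V) + vert w) <= dd x y.
Proof.
apply: dd_ge => s xys.
pose tr c : R -> N := fun t => (c t : V) + vert w.
have trD c t : derivable (c : R -> V) t 1 ->
    derivable (tr c : R -> V) t 1 /\ derive1 (tr c : R -> V) t = derive1 (c : R -> V) t.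
  exact: derive1_translate.
have trC c : C1_curve c -> C1_curve (tr c).
  move=> /C1_curveP cC1; apply/C1_curveP => t /cC1 [cd cc]; split.
    by apply: filterS cd => u /trD [].
  have E : \forall u \near t, derive1 (c : R -> V) u = derive1 (tr c : R -> V) u.
    by apply: filterS cd => u /trD [].
  have Et := nbhs_singleton E.
  by apply: (cvg_trans (near_eq_cvg E)); rewrite -Et.
have trS c t : C1_curve c -> 0 <= t <= 1 -> speed (tr c) t = speed c t.
  move=> cC1 t01; rewrite !speedE; have [_ ->] := trD c t (C1_derivable cC1 t01).
  by congr Num.sqrt; apply: eq_bigr => i _; rewrite coef_vert.
have trL c : C1_curve c -> clen (tr c) = clen c.
  move=> cC1; apply: eq_Rintegral => t t01; apply: trS => //.
  by move: t01; rewrite inE.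
have [h1 h2] : piecewise_C1 ((x : V) + vert w : N) ((y : V) + vert w) (map tr s) /\
    plen (map tr s) = plen s.
  rewrite /plen; elim: s x xys => [|c s IH] x /=.
    by move=> ->; rewrite big_nil.
  case=> cC1 c0 c1s; have [IH1 IH2] := IH _ c1s.
  split; last by rewrite !big_cons IH2 (trL _ cC1).
  by split; [exact: trC|rewrite /tr c0|exact: IH1].
by rewrite -h2; apply: dd_le_plen.
Qed.

Lemma derive1_coord (c : R -> V) t i : derivable c t 1 ->
  derivable (fun t => c t 0 i) t 1 /\ derive1 (fun t => c t 0 i) t = derive1 c t 0 i.
Proof.
move=> dc; split; first by move/derivable_mxP : dc.
by rewrite !derive1E (derive_mx dc) mxE.
Qed.

Lemma derive1_along (f : V -> R) (c : R -> V) t :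
  differentiable f (c t) -> derivable c t 1 ->
  derivable (f \o c) t 1 /\
  derive1 (f \o c) t = \sum_i derive1 c t 0 i * partial i f (c t).
Proof.
move=> df dc.
have dc' : differentiable c t by apply/derivable1_diffP.
have dfc : differentiable (f \o c) t by apply: differentiable_comp.
split; first by apply/derivable1_diffP.
rewrite derive1E' // diff_comp //= (deriv1E dc) scale1r.
rewrite [X in 'd f (c t) X]row_sum_delta linear_sum; apply: eq_bigr => i _.
by rewrite linearZ /= /partial deriveE.
Qed.

(** With L = [log_s] and D = [rat_s], the squared gradient of L is $4 s D^2 / (L^4 D) \le 4 / L^4$,
    which is below 1 as $L \ge 8$. *)
Lemma log_s_speed c t : derivable (c : R -> V) t 1 ->
  derivable (@log_s R m \o (c : R -> V)) t 1 /\
  `|derive1 (@log_s R m \o (c : R -> V)) t| <= 1 * speed c t.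
Proof.
move=> dc; have [d ->] := derive1_along (differentiable_log_s (c t)) dc.
split=> //; rewrite mul1r speedE -sqrtr_sqr ler_wsqrtr //.
set v := derive1 (c : R -> V) t.
have hx_hor i : hx i (c t) = hx i (c t) * hor R i.
  by rewrite /hx /hor; case: (i != _); rewrite ?mulr1 // !mul0r.
under eq_bigr do rewrite partial_log_s.
have -> : \sum_i v 0 i * (2 * hx i (c t) * rat_s (c t)) =
    2 * rat_s (c t) * \sum_i hx i (c t) * (hor R i * v 0 i).
  by rewrite mulr_sumr; apply: eq_bigr => i _; rewrite {1}hx_hor; ring.
have CS := sum_sqr_mul_le (fun i => hx i (c t)) (fun i => hor R i * v 0 i).
have [D0 X8] := (rat_s_gt0 (c t), log_s_ge8 (c t)).
rewrite exprMn.
apply: le_trans (ler_wpM2l (sqr_ge0 _) CS) _.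
rewrite -/(sq (c t)).
have sD : sq (c t) * rat_s (c t) <= 1.
  by rewrite ler_pdivrMr ?sq1_gt0 // mul1r lerDr.
rewrite mulr_sumr mulr_sumr; apply: ler_sum => i _.
rewrite /coef /hor; have [im|im] /= := eqVneq i ord_max.
  rewrite mul0r expr0n !mulr0 mulr_ge0 ?sqr_ge0 // ltW //.
  exact: inv_log_gt0.
rewrite mul1r.
apply: (@le_trans _ _ ((2 * rat_s (c t)) ^+ 2 * sq (c t) * v 0 i ^+ 2)).
  by rewrite -[X in _ <= X]mulrA.
apply: ler_wpM2r; first exact: sqr_ge0.
change ((2 * rat_s (c t)) ^+ 2 * sq (c t) <=
   log_s (c t) * log_s (c t) * (log_s (c t) * log_s (c t)) * rat_s (c t)).
apply: (@le_trans _ _ (4 * rat_s (c t))).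
  have -> : (2 * rat_s (c t)) ^+ 2 * sq (c t) = 4 * rat_s (c t) * (sq (c t) * rat_s (c t)).
    by ring.
  by rewrite ler_piMr // mulr_ge0 // ltW.
apply: ler_wpM2r; first exact: ltW.
have XX : 64 <= log_s (c t) * log_s (c t) by nra.
by nra.
Qed.

Lemma log_s_lipschitz x y : `|log_s (y : V) - log_s (x : V)| <= dd x y.
Proof.
apply: dd_ge => s xys; rewrite -[leRHS]mul1r.
apply: (path_lipschitz (psi := @log_s R m : N -> R) (Q := fun=> True) _ xys) => // c cC1 _.
apply: (clen_lipschitz (psi := @log_s R m \o (c : R -> V)) cC1) => t t01.
exact: (log_s_speed (C1_derivable cC1 t01)).
Qed.

(** Where [log_s] is at most [r], the vertical coefficient is at least $1 / r$. *)
Lemma vert_coord_speed c t r : derivable (c : R -> V) t 1 -> log_s (c t : V) <= r ->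
  `|derive1 (fun t => (c t : V) 0 ord_max) t| <= Num.sqrt r * speed c t.
Proof.
move=> dc cr; have [_ ->] := derive1_coord ord_max dc.
have X0 := log_s_gt0 (c t : V); have Y0 := inv_log_gt0 (c t : V).
have r0 : 0 <= r by apply: le_trans cr; exact: ltW.
rewrite speedE -sqrtrM // -sqrtr_sqr ler_wsqrtr //.
set v := derive1 (c : R -> V) t.
apply: (@le_trans _ _ (r * (inv_log (c t : V) * v 0 ord_max ^+ 2))).
  rewrite mulrA ler_peMl ?sqr_ge0 //.
  by rewrite ler_pdivlMr ?mul1r.
rewrite ler_wpM2l // (bigD1 ord_max) //= coef_max lerDl.
by apply: sumr_ge0 => i _; rewrite mulr_ge0 ?sqr_ge0 // ltW // ev_coef_gt0.
Qed.

Lemma vert_coord_path x y s r : piecewise_C1 x y s ->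
  (forall p, on_path x s p -> log_s (p : V) <= r) ->
  `|(y : V) 0 ord_max - (x : V) 0 ord_max| <= Num.sqrt r * plen s.
Proof.
move=> xys sr.
apply: (path_lipschitz (psi := (fun p => (p : V) 0 ord_max) : N -> R)
  (Q := fun p => log_s (p : V) <= r) _ xys) => // c cC1 cr.
apply: (clen_lipschitz (psi := fun t => (c t : V) 0 ord_max)) => // t t01.
have dc := C1_derivable cC1 t01; split; first by have [] := derive1_coord ord_max dc.
by apply: vert_coord_speed => //; apply: cr.
Qed.

End Estimates.

(** * The spherical Busemann function *)

Section Busemann.
Variables (R : realType) (m : nat).
Hypothesis m0 : (0 < m)%N.
Local Notation V := 'rV[R]_m.+1.
Local Notation N := (warped R m).
Implicit Types (c : R -> N) (x y z p q : N) (s : seq (R -> N)).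

(** * Bounded balls and completeness *)

Lemma norm_rV_le (v : V) M : 0 <= M -> (forall i, `|v 0 i| <= M) -> `|v| <= M.
Proof.
move=> M0 vM; rewrite [leLHS]/Num.Def.normr /= mx_normrE.
by apply: bigmax_le => // -[i j] _ /=; rewrite (ord1 i).
Qed.

(** One has $|u_i| \le 1 + u_i^2 \le 1 + s = e^{L - 8}$ with L = [log_s u]. *)
Lemma hor_coord_le (u : V) i : i != ord_max -> `|u 0 i| <= expR (log_s u).
Proof.
move=> im; apply: (@le_trans _ _ (1 + sq u)).
  have : hx i u ^+ 2 <= sq u.
    rewrite /sq (bigD1 i) //= lerDl; apply: sumr_ge0 => j _; exact: sqr_ge0.
  rewrite /hx /hor im mul1r -real_normK ?num_real //.
  have := sqr_ge0 (`|u 0 i| - 1); have := normr_ge0 (u 0 i); nra.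
rewrite -[1 + sq u]lnK ?posrE ?sq1_gt0 // ler_expR /log_s; lra.
Qed.

Lemma hor0 : (ord0 : 'I_m.+1) != ord_max.
Proof. by rewrite -val_eqE /= eq_sym -lt0n. Qed.

(** The witness lies on the first axis, which is horizontal as [0 < m]; there $\ln(1 + e^{2T}) \ge
    T$. *)
Lemma log_s_unbounded T : exists a : V, a 0 ord_max = 0 /\ T <= log_s a.
Proof.
exists (expR T *: delta_mx 0 ord0); split.
  by rewrite !mxE eq_sym (negbTE hor0) andbF mulr0.
have E : sq (expR T *: delta_mx 0 ord0 : V) = expR T ^+ 2.
  rewrite /sq (bigD1 ord0) //= big1 ?addr0.
    by rewrite /hx /hor hor0 !mxE !eqxx mul1r mulr1.
  move=> i /negbTE i0; rewrite /hx !mxE i0 andbF !mulr0 expr0n //.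
rewrite /log_s E; apply: (@le_trans _ _ (ln (1 + expR T ^+ 2))); last by lra.
rewrite -{1}(expRK T) ler_ln ?posrE ?expR_gt0 //.
by have := sqr_ge0 (expR T - 1); have := expR_gt0 T; nra.
Qed.

Lemma on_path_end x y s : piecewise_C1 x y s -> on_path x s y.
Proof.
elim: s x => [|c s IH] x /=; first by left.
by case=> _ _ /IH; right; right.
Qed.

Lemma dd_ball_bounded p r : exists M, forall q, dd p q <= r -> `|q : V| <= M.
Proof.
(* [L] bounds [log_s] along every path from [p] of length below $|r| + 1$, as [log_s] is
   1-Lipschitz. This controls the horizontal coordinates by [expR L] and the vertical speed by
   [Num.sqrt L]; the extra 1 is the slack of [dd_approx]. *)
pose L := log_s (p : V) + (`|r| + 1).
pose M := expR L + (`|(p : V) 0 ord_max| + Num.sqrt L * (`|r| + 1)).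
have r0 := normr_ge0 r.
have M1 : 0 <= `|(p : V) 0 ord_max| + Num.sqrt L * (`|r| + 1).
  by rewrite addr_ge0 // mulr_ge0 ?sqrtr_ge0 // addr_ge0.
exists M => q pq.
have pqr : dd p q <= `|r| by apply: le_trans pq (ler_norm _).
apply: norm_rV_le; first by rewrite addr_ge0 ?expR_ge0.
move=> i; have [->|im] := eqVneq i ord_max; last first.
  apply: (@le_trans _ _ (expR L)); last by rewrite lerDl.
  apply: le_trans (hor_coord_le q im) _; rewrite ler_expR.
  have := log_s_lipschitz p q; rewrite ler_norml => /andP [_ h].
  rewrite /L; lra.
apply: (@le_trans _ _ (`|(p : V) 0 ord_max| + Num.sqrt L * (`|r| + 1))); last first.
  by rewrite lerDr expR_ge0.
have [s [pqs sr]] := dd_approx p q ltr01.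
have h := @vert_coord_path _ _ p q s L pqs.
have {}h : `|(q : V) 0 ord_max - (p : V) 0 ord_max| <= Num.sqrt L * plen s.
  apply: h => z sz.
  have := log_s_lipschitz p z; rewrite ler_norml => /andP [_ h].
  have := dd_split pqs sz; have := dd_ge0 z q; rewrite /L; lra.
have h2 : Num.sqrt L * plen s <= Num.sqrt L * (`|r| + 1).
  by rewrite ler_wpM2l ?sqrtr_ge0 //; lra.
rewrite -[X in `|X|](subrK ((p : V) 0 ord_max)) addrC.
by apply: le_trans (ler_normD _ _) _; rewrite lerD2l (le_trans h h2).
Qed.

Lemma warped_complete : complete_manifold N.
Proof.
move=> x xC.
have [k0 k0P] := xC 1 ltr01.
have [M MP] := dd_ball_bounded (x k0) 1.
pose A := closed_ball (0 : V) (`|M| + 1).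
have M1 : 0 < `|M| + 1 by rewrite ltr_wpDl.
have cA : compact A.
  apply: bounded_closed_compact; last exact: closed_ball_closed.
  exists (`|M| + 1); split; first exact: num_real.
  move=> r Mr v; rewrite /A closed_ballE // /closed_ball_ /= sub0r normrN => vM.
  by apply: le_trans vM _; exact: ltW.
have FA : (x k : V) @[k --> \oo] A.
  exists k0 => // k /= k0k; rewrite /A closed_ballE // /closed_ball_ /= sub0r normrN.
  apply: (@le_trans _ _ M); last by rewrite (le_trans (ler_norm _)) // lerDl.
  apply: MP; have := k0P k0 k (leqnn _) k0k.
  by rewrite distE lte_fin => /ltW.
(* A cluster point suffices: some late [x k] is close to [y] in norm, hence in distance, and the
   Cauchy condition ties the other late terms to it. *)
have [y [_ yF]] := cA _ _ FA.
exists y => e e0; have e20 : 0 < e / 2 by rewrite divr_gt0.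
have [k1 k1P] := xC _ e20.
exists k1 => l k1l.
have C0 := norm_const_gt0 R m.
have F1 : (x k : V) @[k --> \oo] [set v | exists k, (k1 <= k)%N /\ v = x k].
  by exists k1 => // k /= k1k; exists k.
have B1 : nbhs y (ball (y : V) (e / 2 / norm_const R m)).
  by apply: nbhsx_ballx; rewrite divr_gt0.
have [v [[k [k1k ->]] yk]] := yF _ _ F1 B1.
rewrite distE lte_fin.
have h1 : dd (x l) (x k) < e / 2 by have := k1P l k k1l k1k; rewrite distE lte_fin.
have h2 : dd (x k) y < e / 2.
  apply: le_lt_trans (dd_le_norm _ _) _.
  by move: yk; rewrite -ball_normE /= ltr_pdivlMr // mulrC.
have := dd_triangle (x k) (x l) y; lra.
Qed.

Lemma setT_rV_noncompact : ~ compact [set: V].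
Proof.
move=> /compact_bounded [M [_ MP]].
have := MP (M + 1); rewrite ltrDl ltr01 => /(_ isT (vert m (M + 2)) I) /= h.
have := ler_coord (vert m (M + 2)) ord_max; rewrite vert_max.
by have := ler_norm (M + 2); lra.
Qed.

Lemma warped_open : open_manifold N.
Proof. by split; [exact: warped_complete|exact: setT_rV_noncompact]. Qed.

Lemma dd_continuous p : continuous (dd p : V -> R).
Proof.
move=> q; apply/(@cvgrPdist_le _ _ _ _ (nbhs_filter (q : V))) => e e0.
have C0 := norm_const_gt0 R m.
have e0' : 0 < e / norm_const R m by rewrite divr_gt0.
have /(@cvgrPdist_le _ _ _ _ (nbhs_filter (q : V))) /(_ _ e0') :
  id @ (q : V) --> (q : V) by exact: cvg_id.
move=> near_q; apply: (@filterS _ _ (nbhs_filter (q : V)) _ _ _ near_q) => q' /=.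
rewrite ler_pdivlMr // mulrC => qq'.
have h1 := dd_le_norm q' q.
have h2 := dd_le_norm q q'; rewrite distrC in h2.
have := dd_triangle q p q'; have := dd_triangle q' p q.
rewrite ler_distl; lra.
Qed.

(** Distances from [p] are unbounded since [log_s] is unbounded and 1-Lipschitz. Nonempty spheres
    make [dist_set] finite. *)
Lemma sphere_point p t : 0 <= t -> exists q, dd p q = t.
Proof.
move=> t0; have [a [_ aT]] := log_s_unbounded (log_s (p : V) + t).
have h : t <= dd p a.
  have := log_s_lipschitz p a; rewrite ler_norml => /andP [_]; lra.
have [|q [_ qt]] := @path_IVT _ _ p a [:: seg p a] (dd p) t (piecewise_seg p a) (@dd_continuous p).
  by rewrite dd_refl t0.
by exists q.
Qed.

(** * Distance to spheres and existence of the Busemann limit *)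

Definition sphere_dist p x t : R := fine (dist_set x (geodesic_sphere t p)).

Section SphereDist.
Variables p x : N.

Lemma sphere_distE t : 0 <= t ->
  dist_set x (geodesic_sphere t p) = (sphere_dist p x t)%:E.
Proof.
move=> /(sphere_point p) [q qt]; rewrite /sphere_dist fineK //; apply/fin_numPlt.
apply/andP; split.
  apply: (@lt_le_trans _ _ 0%E); first by rewrite ltNyr.
  by apply: le_ereal_inf_tmp => _ [z _ <-]; apply: dist_ge0.
apply: (@le_lt_trans _ _ (dist x q)); last by rewrite distE ltry.
by apply: ereal_inf_lbound; exists q => //; rewrite /geodesic_sphere /= distE qt.
Qed.

Lemma sphere_dist_le t q : dd p q = t -> sphere_dist p x t <= dd x q.
Proof.
move=> qt; have t0 : 0 <= t by rewrite -qt dd_ge0.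
rewrite -lee_fin -sphere_distE // -distE.
by apply: ereal_inf_lbound; exists q => //; rewrite /geodesic_sphere /= distE qt.
Qed.

Lemma sphere_dist_ge t r : 0 <= t -> (forall q, dd p q = t -> r <= dd x q) ->
  r <= sphere_dist p x t.
Proof.
move=> t0 h; rewrite -lee_fin -sphere_distE //.
apply: le_ereal_inf_tmp => _ [q + <-]; rewrite /geodesic_sphere /= distE => -[qt].
by rewrite distE lee_fin h.
Qed.

(* A path from [x] to the sphere of radius [t] crosses the sphere of radius [r]
   at a point whose distance to the larger sphere is at least [t - r]. *)
Lemma sphere_dist_mono r t : dd p x <= r -> r <= t ->
  t - sphere_dist p x t <= r - sphere_dist p x r.
Proof.
move=> xr rt; have r0 : 0 <= r by apply: le_trans xr; apply: dd_ge0.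
have t0 : 0 <= t by apply: le_trans rt.
suff : sphere_dist p x r + (t - r) <= sphere_dist p x t by lra.
apply: sphere_dist_ge => // q qt; apply: dd_ge => s xqs.
have [|z [sz zr]] := path_IVT xqs (@dd_continuous p) (r := r).
  by rewrite xr qt.
have h1 := dd_split xqs sz.
have h2 := sphere_dist_le zr.
have := dd_triangle z p q; lra.
Qed.

(** From $t = d(p, x)$ on, the quantity is nonincreasing, and it is at least $-d(x, p)$. The second
    clause lets a single radius bound the limit from above. *)
Lemma busemann_limit : exists l : R,
  ((t%:E - dist_set x (geodesic_sphere t p))%E @[t --> +oo%R] --> l%:E) /\
  forall t, dd p x <= t -> l <= t - sphere_dist p x t.
Proof.
pose T := dd p x.
(* Negating and freezing below [T] makes the function nondecreasing on the whole line. *)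
pose f t : R := - (Num.max t T - sphere_dist p x (Num.max t T)).
have f_mono : nondecreasing_fun f.
  move=> r t rt; rewrite /f lerN2; apply: sphere_dist_mono.
    by rewrite le_max lexx orbT.
  by rewrite ge_max !le_max rt lexx orbT.
have f_ub : has_ubound (range f).
  exists (dd x p) => _ [t _ <-]; rewrite /f.
  have t0 : 0 <= Num.max t T by rewrite le_max (dd_ge0 p x) orbT.
  have [q qt] := sphere_point p t0.
  have := sphere_dist_le qt; have := dd_triangle p x q; rewrite qt; lra.
have f_cvg := nondecreasing_cvgr f_mono f_ub.
exists (- sup (range f)); split; last first.
  move=> t Tt; have : f t <= sup (range f) by apply: ub_le_sup => //; exists t.
  rewrite /f max_l //; lra.
have f_cvgN : (- f t)%:E @[t --> +oo%R] --> (- sup (range f))%:E.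
  by apply: cvg_EFin; [exact: nearW|exact: cvgN].
apply: cvg_trans f_cvgN; apply: near_eq_cvg.
near=> t.
have Tt : T <= t by near: t; apply: nbhs_pinfty_ge; apply: num_real.
have t0 : 0 <= t by apply: le_trans Tt; apply: dd_ge0.
by rewrite /f opprK max_l // sphere_distE.
Unshelve. all: by end_near. Qed.

End SphereDist.

(** * Failure of properness *)

Lemma sphere_far_vert p w : exists T, forall t q, T <= t -> dd p q = t ->
  t - 1 <= dd ((p : V) + vert m w) q.
Proof.
set x : V := (p : V) + vert m w.
(* Where [log_s] exceeds [r], a vertical shift by [w] costs at most $|w| / \sqrt r \le 1$. *)
pose r := w ^+ 2 + 8.
have r0 : 0 < r by rewrite ltr_wpDl // sqr_ge0.
(* The factor 4 turns into 1/2 under the square root: vertical travel at [a] costs at most half of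
   what it costs where [log_s] is at most [r]. *)
have [a [av ar]] := log_s_unbounded (4 * r).
pose p' : V := a + vert m ((p : V) 0 ord_max).
pose C := norm_const R m.
have C0 : 0 < C := norm_const_gt0 R m.
(* [K] bounds the legs from [p] to [p'] and from [q'] to [q]. It does not depend on [q], whose
   horizontal coordinates are at most [expR r] when the path stays in the inner region. *)
pose K := C * `|p' - p| + C * (expR r + `|a|).
have ya : Num.sqrt (inv_log a) * Num.sqrt r <= 2^-1.
  rewrite -sqrtrM ?(ltW (inv_log_gt0 a)) // -[leRHS](@ger0_norm R) ?invr_ge0 //.
  rewrite -sqrtr_sqr ler_wsqrtr // mulrC ler_pdivrMr ?log_s_gt0 //.
  have -> : 2^-1 ^+ 2 * log_s a = 4^-1 * log_s a by congr (_ * _); field.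
  by rewrite ler_pdivlMl.
have ya1 : Num.sqrt (inv_log a) <= 1.
  rewrite -[leRHS]sqrtr1 ler_wsqrtr //.
  have := inv_log_le a; have := inv_log_gt0 a; lra.
(* The detour yields $t \le \ell / 2 + |w| + K$ for a path of length $\ell$, hence $\ell \ge t$
   beyond this threshold. *)
exists (2 * (K + `|w|)) => t q Tt qt; apply: dd_ge => s xqs.
have [[z [sz zr]]|small] := pselect (exists z, on_path x s z /\ r < log_s (z : V)).
  (* Translating by [- w] the part of the path from [x] to [z] leads from [p] to [z'], one unit at
     most from [z]. *)
  pose z' : V := (z : V) + vert m (- w).
  have vK (u : V) : u + vert m (- w) + vert m w = u.
    by rewrite -addrA -scalerDl addNr scale0r addr0.
  have vK' (u : V) : u + vert m w + vert m (- w) = u.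
    by rewrite -addrA -scalerDl subrr scale0r addr0.
  have h1 : dd p z' <= dd x z.
    by have := dd_vert_translate (x : N) z (- w); rewrite /x vK'.
  have h2 : dd z' z <= 1.
    have := dd_vert (z' : N) w; rewrite /z' vK => h; apply: le_trans h _.
    rewrite -sqrtr_sqr -sqrtrM ?(ltW (inv_log_gt0 _)) // -[leRHS]sqrtr1 ler_wsqrtr //.
    rewrite /inv_log log_s_vert mulrC ler_pdivrMr ?log_s_gt0 // mul1r.
    by rewrite /r in zr; lra.
  have h3 := dd_split xqs sz.
  have h4 := dd_triangle z' p q; have h5 := dd_triangle z z' q; lra.
have sr z : on_path x s z -> log_s (z : V) <= r.
  by move=> sz; rewrite leNgt; apply/negP => zr; apply: small; exists z.
have qr := sr _ (on_path_end xqs).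
have vq := vert_coord_path xqs sr.
(* The detour runs from [p] to [p'], vertically to [q'] above [a], then to [q] at the same
   height. *)
pose q' : V := a + vert m ((q : V) 0 ord_max).
have d1 : dd p p' <= C * `|p' - p| := dd_le_norm p p'.
have d2 : dd p' q' <= Num.sqrt (inv_log a) * `|(q : V) 0 ord_max - (p : V) 0 ord_max|.
  have := dd_vert (p' : N) ((q : V) 0 ord_max - (p : V) 0 ord_max).
  rewrite /p' -addrA -scalerDl [_ + (_ - _)]addrC subrK -/q'.
  by rewrite /inv_log log_s_vert.
have d3 : dd q' q <= C * (expR r + `|a|).
  apply: le_trans (dd_le_norm q' q) _; rewrite ler_pM2l //.
  apply: norm_rV_le; first by rewrite addr_ge0 ?expR_ge0.
  move=> i; rewrite /q' mxE [X in _ + X]mxE [X in _ - X]mxE.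
  have [->|im] := eqVneq i ord_max.
    by rewrite vert_max av add0r subrr normr0 addr_ge0 ?expR_ge0.
  rewrite vert_hor // addr0; apply: le_trans (ler_normB _ _) _.
  apply: lerD; last exact: ler_coord.
  by apply: le_trans (hor_coord_le q im) _; rewrite ler_expR.
have vqp : `|(q : V) 0 ord_max - (p : V) 0 ord_max| <= Num.sqrt r * plen s + `|w|.
  have -> : (q : V) 0 ord_max - (p : V) 0 ord_max =
      ((q : V) 0 ord_max - x 0 ord_max) + w.
    by rewrite /x mxE vert_max; ring.
  by apply: le_trans (ler_normD _ _) _; rewrite lerD2r.
have d2' : dd p' q' <= 2^-1 * plen s + `|w|.
  apply: le_trans d2 _.
  apply: le_trans (ler_wpM2l (sqrtr_ge0 _) vqp) _.
  rewrite mulrDr mulrA; apply: lerD.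
    by rewrite ler_wpM2r // plen_ge0.
  by rewrite ler_piMl.
have h1 := dd_triangle p' p q; have h2 := dd_triangle q' p' q.
have w0 := normr_ge0 w.
have K0 : 0 <= K by rewrite addr_ge0 // mulr_ge0 ?(ltW C0) // addr_ge0 // expR_ge0.
rewrite /K in Tt K0 *.
lra.
Qed.

Lemma warped_busemann p : exists b : N -> R,
  is_spherical_busemann p b /\ ~ proper_function b.
Proof.
have /choice [b bP] := busemann_limit p.
exists b; split; first by move=> x; have [] := bP x.
move=> /(_ 1) /(@compact_bounded R V) [M [_ MP]].
have b1 w : b ((p : V) + vert m w) <= 1.
  have [_ bt] := bP ((p : V) + vert m w).
  have [T TP] := sphere_far_vert p w.
  pose t := Num.max T (dd p ((p : V) + vert m w : N)).
  have Tt : T <= t by rewrite le_max lexx.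
  have dt : dd p ((p : V) + vert m w : N) <= t by rewrite le_max lexx orbT.
  apply: le_trans (bt t dt) _.
  have t0 : 0 <= t by apply: le_trans dt; apply: dd_ge0.
  have : t - 1 <= sphere_dist p ((p : V) + vert m w) t.
    by apply: sphere_dist_ge => // q qt; apply: TP.
  lra.
(* The point at parameter [w + 1] has last coordinate [M + 2], against the norm bound [M + 1]. *)
pose w := M + 1 - (p : V) 0 ord_max.
have M1 : M < M + 1 by rewrite ltrDl.
have h := MP (M + 1) M1 ((p : V) + vert m (w + 1)) (b1 _).
have := ler_coord ((p : V) + vert m (w + 1)) ord_max.
rewrite mxE vert_max /w.
have := ler_norm ((p : V) 0 ord_max + (M + 1 - (p : V) 0 ord_max + 1)).
move: h => /=; lra.
Qed.

End Busemann.

Theorem theoremA (R : realType) (n : nat) (hn : (4 <= n)%N) :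
  exists N : riemannian_manifold R n,
    open_manifold N /\ positive_ricci N /\
    forall p : N, exists b : N -> R,
      is_spherical_busemann p b /\ ~ proper_function b.
Proof.
(* With one vertical direction, [4 <= n] leaves [m >= 3] horizontal ones. *)
case: n hn => // m m3; have m0 : (0 < m)%N by apply: leq_trans (m3 : (3 <= m)%N).
exists (warped R m); split; [|split].
- exact: warped_open.
- exact: warped_positive_ricci.
- by move=> p; apply: warped_busemann.
Qed.
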